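(* (1) An increasing function $f:[1,\infty)\to[0,\infty)$ is a martingale calibrator if and only if $$\int_0^1 f(1/x)\,dx\le 1.$$ (2) Any martingale calibrator is dominated by an admissible martingale calibrator. (3) A martingale calibrator $f$ is admissible if and only if it is right-continuous and $$\int_0^1 f(1/x)\,dx=1.$$
   Context: Conventions: ''increasing'' means not necessarily strictly increasing. Random variables may take the values $\pm\infty$. Time: the index $t$ ranges over $\{0,1,2,\ldots\}$ (discrete time) or $[0,\infty)$ (continuous time). A filtration $(\mathcal{F}_t)$ in a probability space $(\Omega,\mathcal{F},\mathbf{P})$ is an indexed family of sub-$\sigma$-algebras of $\mathcal{F}$ with $\mathcal{F}_s\subseteq\mathcal{F}_t$ for $s<t$. $(X_t,\mathcal{F}_t)$ is a supermartingale if $(\mathcal{F}_t)$ is a filtration, each $X_t$ is $\mathcal{F}_t$-measurable and integrable, and $\mathbf{E}(X_t\mid\mathcal{F}_s)\le X_s$ a.s. for all $s<t$. In continuous time it is always assumed that the paths of $(X_t)$ are right-continuous almost surely, and that the filtration $(\mathcal{F}_t)$ satisfies the usual conditions: each $\mathcal{F}_t$ contains all subsets of every $E\in\mathcal{F}$ with $\mathbf{P}(E)=0$, and $\mathcal{F}_t=\bigcap_{s>t}\mathcal{F}_s$. A test supermartingale is a supermartingale with $X_t\ge0$ for all $t$ and $\mathbf{E}(X_0)\le1$. By convention $X_t:=1$ for $t<0$, and $X^*_t:=\sup_{s\le t}X_s$ includes these times; thus $X^*_t=\max(1,\sup_{0\le s\le t}X_s)\ge1$. An increasing function $f:[1,\infty)\to[0,\infty)$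 is a martingale calibrator if: for any probability space $(\Omega,\mathcal{F},\mathbf{P})$ and any test supermartingale $(X_t,\mathcal{F}_t)$ in it (in discrete or continuous time), there exists a test supermartingale $(Y_t,\mathcal{F}_t)$ such that $Y_t\ge f(X^*_t)$ for all $t$ almost surely. Here $f(\infty):=\lim_{x\to\infty}f(x)$ ($X^*_t=\infty$ only with probability zero). A martingale calibrator $g$ dominates a martingale calibrator $f$ if $g(x)\ge f(x)$ for all $x\in[1,\infty)$. A martingale calibrator $f$ is admissible if there is no other martingale calibrator $g$ such that $g(x)\ge f(x)$ for all $x\in[1,\infty)$ and $g(x)>f(x)$ for some $x\in[1,\infty)$. *)

(* Defs.v *)
(* MathComp / MathComp-Analysis. *)
From HB Require Import structures.
From mathcomp Require Import all_boot all_order all_algebra.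
From mathcomp Require Import all_classical all_reals all_analysis.
From mathcomp Require Import measurable_realfun.

Set Implicit Arguments.
Unset Strict Implicit.
Unset Printing Implicit Defensive.

Import Order.TTheory GRing.Theory Num.Theory.
Import numFieldNormedType.Exports.

Local Open Scope classical_set_scope.
Local Open Scope ring_scope.
Local Open Scope ereal_scope.

(* Both time models are embedded in the real line. Families indexed by time
   are families over R whose members outside [time_set m] are irrelevant. *)
Variant time_model := DiscreteTime | ContinuousTime.

Definition time_set (R : realType) (m : time_model) : set R :=
  match m with
  | DiscreteTime => range (fun n : nat => n%:R%R)
  | ContinuousTime => [set t | (0 <= t)%R]
  end.

Section processes.
Context {d : measure_display} {T : measurableType d} {R : realType}.
Implicit Types (P : probability T R) (G : set (set T)) (m : time_model).
Implicit Types (F : R -> set (set T)) (X : R -> T -> \bar R).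

Definition is_sub_sigma_algebra G : Prop :=
  sigma_algebra setT G /\ G `<=` measurable.

Definition measurable_wrt G (Z : T -> \bar R) : Prop :=
  forall B : set (\bar R), measurable B -> G (Z @^-1` B).

(* Z is a version of E(X | G). *)
Definition is_cond_expectation P G (X Z : T -> \bar R) : Prop :=
  [/\ measurable_wrt G Z, P.-integrable setT Z &
      forall A, G A -> \int[P]_(w in A) Z w = \int[P]_(w in A) X w].

Definition usual_conditions P F : Prop :=
  forall t : R, (0 <= t)%R ->
    (forall A, P.-negligible A -> F t A) /\
    F t = \bigcap_(s in [set s : R | (t < s)%R]) F s.

Definition filtration P m F : Prop :=
  [/\ forall t, time_set m t -> is_sub_sigma_algebra (F t),
      forall s t, time_set m s -> time_set m t -> (s < t)%R ->
        F s `<=` F t &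
      m = ContinuousTime -> usual_conditions P F].

Definition right_continuous_paths P X : Prop :=
  {ae P, forall w, forall t : R, (0 <= t)%R ->
    X s w @[s --> t^'+] --> X t w}.

Definition supermartingale P m X F : Prop :=
  [/\ filtration P m F,
      forall t, time_set m t ->
        measurable_wrt (F t) (X t) /\ P.-integrable setT (X t),
      forall s t, time_set m s -> time_set m t -> (s < t)%R ->
        exists2 Z, is_cond_expectation P (F s) (X t) Z &
                   {ae P, forall w, Z w <= X s w} &
      m = ContinuousTime -> right_continuous_paths P X].

Definition test_supermartingale P m X F : Prop :=
  [/\ supermartingale P m X F,
      forall t, time_set m t -> forall w, 0 <= X t w &
      \int[P]_w X 0%R w <= 1].

(* The constant 1 accounts for the convention X_t := 1 for t < 0. *)
Definition running_sup m X (t : R) (w : T) : \bar R :=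
  maxe 1 (ereal_sup [set X s w | s in time_set m `&` [set s | (s <= t)%R]]).

End processes.

Section calibrators.
Context {R : realType}.
(* A function on [1, +oo[ is represented by a function on R whose values
   below 1 are irrelevant. *)
Implicit Types f g : R -> R.

Definition increasing_nonneg f : Prop :=
  (forall x : R, 1 <= x -> 0 <= f x)%R /\
  (forall x y : R, 1 <= x -> x <= y -> f x <= f y)%R.

(* The value at -oo is never used: running suprema are at least 1. *)
Definition extend_at_infty f (x : \bar R) : \bar R :=
  match x with
  | r%:E => (f r)%:E
  | +oo => lim ((f y)%:E @[y --> +oo%R])
  | -oo => 0
  end.

Definition martingale_calibrator f : Prop :=
  increasing_nonneg f /\
  forall (d : measure_display) (T : measurableType d) (P : probability T R)
    (m : time_model) (X : R -> T -> \bar R) (F : R -> set (set T)),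
    test_supermartingale P m X F ->
    exists2 Y : R -> T -> \bar R, test_supermartingale P m Y F &
      {ae P, forall w, forall t, time_set m t ->
        extend_at_infty f (running_sup m X t w) <= Y t w}.

Definition dominates g f : Prop := forall x : R, (1 <= x)%R -> (f x <= g x)%R.

Definition admissible f : Prop :=
  martingale_calibrator f /\
  ~ exists g, [/\ martingale_calibrator g, dominates g f &
                  exists2 x : R, (1 <= x)%R & (f x < g x)%R].

Definition right_continuous_from1 f : Prop :=
  forall x : R, (1 <= x)%R -> f y @[y --> x^'+] --> f x.

Definition calibrator_integral f : \bar R :=
  \int[lebesgue_measure]_(x in `]0%R, 1%R]) (f (1 / x)%R)%:E.

End calibrators.

(* Main.v *)
Require Import Defs.
From HB Require Import structures.
From mathcomp Require Import all_boot all_order all_algebra.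
From mathcomp Require Import all_classical all_reals all_analysis.
From mathcomp Require Import measurable_realfun.
From mathcomp Require Import ring lra.

Set Implicit Arguments.
Unset Strict Implicit.
Unset Printing Implicit Defensive.

Import Order.TTheory GRing.Theory Num.Theory.
Import numFieldNormedType.Exports.

Local Open Scope classical_set_scope.
Local Open Scope ring_scope.
Local Open Scope ereal_scope.

(** Why the theorem holds.

    The bettor whose capital is X keeps a reserve and stakes only a part of
    X.  Attach to f a second function c on [1, oo[ with dc = - df / m: when
    the running maximum M of X passes a level m, the amount df is moved into
    the reserve, and since X equals m at that moment this costs df / m units
    of X.  The capital is then Y = f(M) + c(M) X >= f(M).  Integrating by
    parts, c(m) = g(m) - f(m) / m, where g(m) is the integral of f(1/x) over
    ]0, 1/m].  So the initial capital f(1) + c(1) is the integral of f(1/x)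
    over ]0, 1], and this is why the condition is that the integral is at
    most 1.

    The relation dc = - df / m is used in the form of two inequalities
    between the increments of f and c ([reserve_pair]), which make sense for
    any increasing f.  One of them says that Y lies below the line
    f(m) + c(m) x after a step from a running maximum m to a new value x
    ([wealth_le_line]).  As that line is affine in x with a slope known
    before the step, Y is a supermartingale along any finite set of times
    ([wealth_step], [wealth_grid]).

    In continuous time the maximum over finite grids only tends to M, and f
    may jump at M.  Overshooting by a factor l > 1 repairs this: l times the
    grid maximum eventually exceeds M, hence Y_t is bounded by the capital
    obtained from l X along the grid ([wealth_le_scaled]).  Letting l decrease
    to 1 loses nothing when f is right-continuous ([wealth_integral_le]).
    An arbitrary increasing f is first replaced by its right limit, whose
    integral is not larger.  Discrete time goes through the same
    argument.

    Conversely, for a > 1 let events A_0, A_1, ... decrease with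
    P(A_k) = a^-k, and let X_k = a^k on A_k and 0 elsewhere.  The maximum of X
    is a^k on A_k minus A_(k+1), so that a test supermartingale above f(M)
    forces the sum of f(a^k) (a^-k - a^-(k+1)) to be at most 1
    ([calibrator_geometric_sum_le1]).  As a decreases to 1 these lower sums
    tend to the integral of f(1/x) ([calibrator_integral_le_sums]).

    Given this criterion, the right limit of a calibrator plus a constant is
    a right-continuous calibrator of integral 1 above it
    ([admissible_majorant]).  A right-continuous calibrator of integral 1 is
    maximal, because exceeding it at one point means exceeding it on a right
    neighbourhood, and hence having integral above 1
    ([integral_eq1_admissible]). *)

(** * Integration against a sub-sigma-algebra *)
Section sub_sigma_algebra.
Context {d : measure_display} {T : measurableType d} {R : realType}.
Variables (G : set (set T)).
Hypothesis sG : is_sub_sigma_algebra G.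

Lemma g_sigma_measurableE (A : set T) :
  measurable (A : set (g_sigma_algebraType G)) = G A.
Proof. by rewrite /measurable/= sigma_algebra_id//; case: sG. Qed.

Lemma sub_sigma_measurable (A : set T) : G A -> measurable A.
Proof. by case: sG => _; apply. Qed.

Lemma measurable_wrtP (Z : T -> \bar R) :
  measurable_wrt G Z <->
  measurable_fun [set: g_sigma_algebraType G]
    (Z : g_sigma_algebraType G -> \bar R).
Proof.
split=> [mZ _ B mB|mZ B mB].
  by rewrite setTI g_sigma_measurableE; exact: mZ.
by rewrite -g_sigma_measurableE -[X in measurable X]setTI; exact: mZ.
Qed.

Lemma measurable_wrt_fun (Z : T -> \bar R) :
  measurable_wrt G Z -> measurable_fun setT Z.
Proof. by move=> mZ _ B mB; rewrite setTI; apply/sub_sigma_measurable/mZ. Qed.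

Lemma measurable_forget :
  measurable_fun [set: T] (id : T -> g_sigma_algebraType G).
Proof.
by move=> _ B; rewrite setTI g_sigma_measurableE; exact: sub_sigma_measurable.
Qed.

Lemma sub_sigmaI A B : G A -> G B -> G (A `&` B).
Proof.
move=> GA GB; rewrite -g_sigma_measurableE; apply: measurableI;
by rewrite g_sigma_measurableE.
Qed.

Lemma sub_sigmaT : G setT.
Proof. by rewrite -g_sigma_measurableE; exact: measurableT. Qed.

End sub_sigma_algebra.

Section weighted.
Context {d : measure_display} {T : measurableType d} {R : realType}.
Variables (P : {measure set T -> \bar R}) (G : set (set T)).
Hypothesis sG : is_sub_sigma_algebra G.
Variables (x y : T -> \bar R).
Hypotheses (mx : measurable_fun setT x) (my : measurable_fun setT y).
Hypotheses (x0 : forall w, 0 <= x w) (y0 : forall w, 0 <= y w).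
Hypothesis xy : forall A, G A -> \int[P]_(w in A) x w <= \int[P]_(w in A) y w.

Import HBNNSimple.

Let weighted_sfun (z : T -> \bar R) (mz : measurable_fun setT z)
  (z0 : forall w, 0 <= z w) (A : set T) (GA : G A)
  (h : {nnsfun (g_sigma_algebraType G) >-> R}) :
  \int[P]_(w in A) ((h w)%:E * z w) =
  \sum_(r \in range h) r%:E * \int[P]_(w in A `&` (h @^-1` [set r])) z w.
Proof.
have mA := sub_sigma_measurable sG GA.
have mh r : measurable (h @^-1` [set r] : set T).
  apply: (sub_sigma_measurable sG); rewrite -(g_sigma_measurableE sG).
  exact: measurable_funPTI.
transitivity (\int[P]_(w in A)
    (\sum_(r \in range h) (r * \1_(h @^-1` [set r]) w)%:E * z w)).
  apply: eq_integral => w _.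
  rewrite {1}(fimfunE h) -fsumEFin// ge0_mule_fsuml//.
  by move=> r; rewrite EFinM nnfun_muleindic_ge0.
rewrite ge0_integral_fsum//; last first.
- by move=> r w _; rewrite mule_ge0// EFinM nnfun_muleindic_ge0.
- move=> r; apply: emeasurable_funM; last exact: measurable_funTS.
  by apply/measurable_EFinP/measurable_funM => //; exact: measurable_indic.
apply: eq_fsbigr => r; rewrite inE => -[w _ <-].
under eq_integral do rewrite EFinM -muleA.
rewrite ge0_integralZl//; last first.
- by rewrite lee_fin.
- by move=> u _; rewrite mule_ge0.
- apply: emeasurable_funM; last exact: measurable_funTS.
  by apply/measurable_EFinP; exact: measurable_indic.
congr (_ * _); rewrite integral_mkcondr; apply: eq_integral => u _.
by rewrite epatch_indic muleC.
Qed.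

(** Integrating a nonnegative weight measurable for the small sigma-algebra
    preserves a comparison known on its members: the weight is an increasing
    limit of simple functions, for which both sides are combinations of
    integrals over members. *)
Lemma le_integral_weighted (h : T -> \bar R) A :
  measurable_wrt G h -> (forall w, 0 <= h w) -> G A ->
  \int[P]_(w in A) (h w * x w) <= \int[P]_(w in A) (h w * y w).
Proof.
move=> /(measurable_wrtP sG) mh h0 GA.
have mA := sub_sigma_measurable sG GA.
pose h_ := nnsfun_approx measurableT mh.
have mh_ n : measurable_fun [set: T] (fun w => (h_ n w)%:E : \bar R).
  apply/(measurable_wrt_fun sG)/measurable_wrtP => //.
  exact/measurable_EFinP.
have h_cvg (z : T -> \bar R) w : 0 <= z w ->
    (h_ n w)%:E * z w @[n --> \oo] --> h w * z w.
  have hw : (h_ n w)%:E @[n --> \oo] --> h w by exact: cvg_nnsfun_approx.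
  case: (z w) => [r _| _|//]; first exact: cvgeZr.
  have [hw0|hw0] := eqVneq (h w) 0.
    apply: cvg_near_cst; apply: nearW => n; rewrite hw0 mul0e.
    have : (h_ n w)%:E <= h w.
      apply: (lee_cvg_to (cvg_cst _) hw); near=> k.
      have nk : (n <= k)%N by near: k; exact: nbhs_infty_ge.
      rewrite lee_fin.
      by have /lefP/(_ w) := nd_nnsfun_approx measurableT mh nk.
    rewrite hw0 lee_fin => h0'; have -> : h_ n w = 0%R.
      by apply/eqP; rewrite eq_le h0'/=.
    by rewrite mul0e.
  apply: cvgeM => //; last exact: cvg_cst.
  by rewrite mule_def_neq0_infty.
have approx (z : T -> \bar R) : measurable_fun setT z -> (forall w, 0 <= z w) ->
    \int[P]_(w in A) ((h_ n w)%:E * z w) @[n --> \oo] -->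
    \int[P]_(w in A) (h w * z w).
  move=> mz z0.
  rewrite (_ : \int[P]_(w in A) (h w * z w) =
    \int[P]_(w in A) limn (fun n => (h_ n w)%:E * z w)); last first.
    apply: eq_integral => w _; apply/esym/cvg_lim => //.
    exact: h_cvg.
  apply: cvg_monotone_convergence => //=.
  - move=> n; apply: emeasurable_funM; apply: measurable_funTS => //.
  - by move=> n w _; rewrite mule_ge0// lee_fin.
  - move=> w _ n m nm; rewrite lee_wpmul2r//.
    by have /lefP/(_ w) := nd_nnsfun_approx measurableT mh nm; rewrite -lee_fin.
apply: (lee_cvg_to (approx _ mx x0) (approx _ my y0)).
apply: nearW => n; rewrite !weighted_sfun//.
apply: lee_fsum => // r [w _ <-]; rewrite lee_wpmul2l ?lee_fin//.
apply: xy; apply: sub_sigmaI => //.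
by rewrite -(g_sigma_measurableE sG); exact: measurable_funPTI.
Unshelve. all: by end_near. Qed.

End weighted.

Section integral_measure.
Context {d : measure_display} {T : measurableType d} {R : realType}.
Variables (P : {measure set T -> \bar R}) (G : set (set T)).
Hypothesis sG : is_sub_sigma_algebra G.
Variables (X : T -> \bar R).
Hypotheses (X0 : forall w, 0 <= X w) (iX : P.-integrable setT X).

(** The measure whose density with respect to [P] is a conditional
    expectation of [X].  The proofs are arguments so that its measure
    structure can be found by unification. *)
Definition trace_integral of is_sub_sigma_algebra G & (forall w, 0 <= X w) &
    P.-integrable setT X : set (g_sigma_algebraType G) -> \bar R :=
  fun A => \int[P]_(w in (A : set T)) X w.

Local Notation nu := (trace_integral sG X0 iX).

Let nu0 : nu set0 = 0. Proof. exact: integral_set0. Qed.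

Let nu_ge0 A : 0 <= nu A. Proof. exact: integral_ge0. Qed.

Let nu_sigma_additive : semi_sigma_additive nu.
Proof.
move=> F mF tF mUF; rewrite /trace_integral.
have mF' n : measurable (F n : set T).
  by apply: (sub_sigma_measurable sG); rewrite -(g_sigma_measurableE sG).
rewrite ge0_integral_bigcup//; last first.
  by apply: measurable_funTS; case/integrableP: iX.
apply: is_cvg_ereal_nneg_natsum => n _; exact: integral_ge0.
Qed.

HB.instance Definition _ :=
  isMeasure.Build _ _ _ nu nu0 nu_ge0 nu_sigma_additive.

Let nu_fin : fin_num_fun nu.
Proof.
move=> A; rewrite (g_sigma_measurableE sG) => GA.
apply: integrable_fin_num; first exact: (sub_sigma_measurable sG GA).
by apply: integrableS iX => //; exact: (sub_sigma_measurable sG GA).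
Qed.

HB.instance Definition _ := @Measure_isFinite.Build _ _ _ nu nu_fin.

Definition trace_integral_finite :
  {finite_measure set (g_sigma_algebraType G) -> \bar R} := nu.

End integral_measure.

Section conditional_expectation.
Context {d : measure_display} {T : measurableType d} {R : realType}.
Variables (P : probability T R) (G : set (set T)).
Hypothesis sG : is_sub_sigma_algebra G.

Let one_ge0 (w : T) : 0 <= (cst 1 w : \bar R). Proof. exact: lee01. Qed.

Let one_integrable : P.-integrable setT (cst 1).
Proof. by apply: finite_measure_integrable_cst. Qed.

(* The restriction of P to G, as the indefinite integral of 1. *)
Local Notation PG := (trace_integral_finite sG one_ge0 one_integrable).

Let PGE A : G A -> PG A = P A.
Proof.
move=> /(sub_sigma_measurable sG) mA.
by rewrite /trace_integral_finite/= /trace_integral integral_cst// mul1e.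
Qed.

Let integral_PG (f : g_sigma_algebraType G -> \bar R) A :
  measurable_fun setT f -> (forall w, 0 <= f w) -> G A ->
  \int[PG]_(w in A) f w = \int[P]_(w in A) f w.
Proof.
move=> mf f0 GA.
have mA : measurable (A : set (g_sigma_algebraType G)).
  by rewrite (g_sigma_measurableE sG).
have := ge0_integral_pushforward (measurable_forget sG) P mA
  (measurable_funTS mf) (fun w _ => f0 w).
rewrite preimage_id/= => <-.
apply: eq_measure_integral => [|mB B mB0 _]; first exact: measurable_forget.
apply: PGE.
by rewrite -(g_sigma_measurableE sG).
Qed.

(** A conditional expectation is produced by Radon-Nikodym on the small
    sigma-algebra.  It lies below [Y] because the event where it exceeds [Y]
    is itself a member on which the integrals compare the other way. *)
Lemma cond_expectation_le (X Y : T -> \bar R) :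
  measurable_fun setT X -> (forall w, 0 <= X w) ->
  measurable_wrt G Y -> (forall w, 0 <= Y w) ->
  \int[P]_w Y w < +oo ->
  (forall A, G A -> \int[P]_(w in A) X w <= \int[P]_(w in A) Y w) ->
  exists2 Z, is_cond_expectation P G X Z & {ae P, forall w, Z w <= Y w}.
Proof.
move=> mX X0 mY Y0 Yoo XY.
have iX : P.-integrable setT X.
  apply/integrableP; split => //.
  under eq_integral do rewrite gee0_abs//.
  by apply: le_lt_trans Yoo; apply: XY; exact: (sub_sigmaT sG).
pose nu := trace_integral_finite sG X0 iX.
have nuPG : nu `<< PG.
  apply/null_content_dominatesP => A mA'.
  have GA : G A by rewrite -(g_sigma_measurableE sG).
  move=> PGA; have PA0 : P A = 0 by rewrite -(PGE GA).
  rewrite /nu /trace_integral_finite/= /trace_integral.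
  apply: null_set_integral => //; first exact: (sub_sigma_measurable sG).
  exact: measurable_funTS.
have [Z [Z0 Zfin iZ ZE]] := radon_nikodym_sigma_finite nuPG.
have mZ : measurable_fun setT Z by case/integrableP: iZ.
have mZw : measurable_wrt G Z by apply/measurable_wrtP.
have mZT : measurable_fun [set: T] Z by exact: (measurable_wrt_fun sG).
have ZX A : G A -> \int[P]_(w in A) Z w = \int[P]_(w in A) X w.
  by move=> GA; rewrite -integral_PG// -ZE// (g_sigma_measurableE sG).
have GT := sub_sigmaT sG.
have iZP : P.-integrable setT Z.
  apply/integrableP; split => //.
  under eq_integral do rewrite gee0_abs//.
  by rewrite ZX//; apply: le_lt_trans Yoo; exact: XY.
exists Z; first by split.
have iY : P.-integrable setT Y.
  apply/integrableP; split; first exact: (measurable_wrt_fun sG).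
  by under eq_integral do rewrite gee0_abs//.
pose A := [set w | Y w < Z w].
have GA : G A.
  rewrite -(g_sigma_measurableE sG) -[A]setTI.
  apply: emeasurable_fun_lt => //; exact/measurable_wrtP.
have mA := sub_sigma_measurable sG GA.
have YZA : \int[P]_(w in A) (Z w - Y w) = 0.
  apply/eqP; rewrite eq_le; apply/andP; split; last first.
    by apply: integral_ge0 => w Aw; rewrite sube_ge0 ?Zfin ?orbT// ltW.
  rewrite integralB//; [|exact: integrableS iZP|exact: integrableS iY].
  rewrite sube_le0 ZX//; exact: XY.
have : ae_eq P A (fun w => Z w - Y w) (cst 0).
  apply/(ae_eq_integral_abs P mA).
    apply: measurable_funTS; apply: emeasurable_funB => //.
    exact: (measurable_wrt_fun sG).
  rewrite -[RHS]YZA; apply: eq_integral => w; rewrite inE => Aw.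
  by rewrite gee0_abs// sube_ge0 ?Zfin ?orbT// ltW.
apply: filterS => w /= AZY; rewrite leNgt; apply/negP => YZ.
have /eqP := AZY YZ; rewrite sube_eq// add0e => /eqP ZY.
by move: YZ; rewrite ZY ltxx.
Qed.

(** Together with [cond_expectation_le], this turns the supermartingale
    property into a comparison of integrals over the members of [G].  The
    positive part is taken because [Z] is only almost surely nonnegative. *)
Lemma cond_expectation_integral_le (X Y Z : T -> \bar R) :
  is_cond_expectation P G X Z -> {ae P, forall w, Z w <= Y w} ->
  measurable_fun setT Y -> (forall w, 0 <= Y w) ->
  forall A, G A -> \int[P]_(w in A) X w <= \int[P]_(w in A) Y w.
Proof.
move=> [mZ iZ ZX] ZY mY Y0 A GA; rewrite -ZX//.
have mA := sub_sigma_measurable sG GA.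
have mZ' : measurable_fun setT Z by case/integrableP: iZ.
have mZp : measurable_fun setT Z^\+ by exact: measurable_funepos.
apply: (@le_trans _ _ (\int[P]_(w in A) Z^\+ w)).
  apply: le_integral => //; first exact: integrableS iZ.
    by apply: (integrableS measurableT) => //; exact: integrable_funepos.
  by move=> w _; rewrite funeposE le_max lexx.
apply: ae_ge0_le_integral => //.
- exact: measurable_funTS.
- exact: measurable_funTS.
- by apply: filterS ZY => w Zw _; rewrite funeposE ge_max Zw Y0.
Qed.

End conditional_expectation.

(** * Reserve and stake as functions of the running maximum *)
Section wealth.
Context {R : realType}.
Implicit Types (f c : R -> R).

(** The inequalities are the Riemann bounds for [dc = - df / m]; they also
    force [f] to be nondecreasing and [c] to be nonincreasing. *)
Definition reserve_pair f c : Prop :=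
  [/\ forall m, 1 <= m -> 0 <= f m, forall m, 1 <= m -> 0 <= c m &
      forall m m', 1 <= m -> m <= m' ->
        m * (c m - c m') <= f m' - f m <= m' * (c m - c m')]%R.

Lemma reserve_pair_nonincreasing f c : reserve_pair f c ->
  forall m m', (1 <= m -> m <= m' -> c m' <= c m)%R.
Proof.
move=> [f0 c0 fc] m m' m1; rewrite le_eqVlt => /orP[/eqP->//|mm'].
have /andP[h1 h2] := fc _ _ m1 (ltW mm').
have : (0 <= (m' - m) * (c m - c m'))%R by lra.
by rewrite pmulr_rge0 ?subr_gt0// subr_ge0.
Qed.

Lemma reserve_pair_nondecreasing f c : reserve_pair f c ->
  forall m m', (1 <= m -> m <= m' -> f m <= f m')%R.
Proof.
move=> fc m m' m1 mm'; have cc := reserve_pair_nonincreasing fc m1 mm'.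
case: fc => _ _ /(_ _ _ m1 mm')/andP[h _].
have : (0 <= m * (c m - c m'))%R by rewrite mulr_ge0// ?subr_ge0//; lra.
by lra.
Qed.

(** Playing with [l X] instead of [X]: the capital of this pair at [(m, x)] is
    that of [(f, c)] at [(l m, l x)]. *)
Lemma reserve_pair_scale f c (l : R) : (1 <= l)%R -> reserve_pair f c ->
  reserve_pair (fun m => f (l * m))%R (fun m => l * c (l * m))%R.
Proof.
move=> l1 [f0 c0 fc].
have lm1 m : (1 <= m -> 1 <= l * m)%R by move=> m1; rewrite mulr_ege1.
split=> [m m1|m m1|m m' m1 mm'].
- exact/f0/lm1.
- by rewrite mulr_ge0 ?c0 ?lm1//; lra.
- have l0 : (0 <= l)%R by lra.
  have := fc _ _ (lm1 _ m1) (ler_wpM2l l0 mm').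
  by move=> /andP[h1 h2]; apply/andP; split; lra.
Qed.

(** At an infinite running maximum the capital is set to [+oo], so that it
    stays above every extension of [f]; this happens with probability 0. *)
Definition reserve f (m : \bar R) : \bar R :=
  if m \is a fin_num then (f (fine m))%:E else +oo.

Definition stake c (m : \bar R) : \bar R :=
  if m \is a fin_num then (c (fine m))%:E else 0.

Definition wealth f c (m x : \bar R) := reserve f m + stake c m * x.

Lemma wealthE f c (m x : R) : wealth f c m%:E x%:E = (f m + c m * x)%:E.
Proof. by []. Qed.

Section pair.
Variables f c : R -> R.
Hypothesis fc : reserve_pair f c.

Lemma reserve_ge0 m : 1 <= m -> 0 <= reserve f m.
Proof.
case: m => [r r1|_|//]; last by rewrite /reserve leey.
by rewrite /reserve/= lee_fin; case: fc => + _ _; apply.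
Qed.

Lemma stake_ge0 m : 1 <= m -> 0 <= stake c m.
Proof.
case: m => [r r1|_|//]; last by rewrite /stake.
by rewrite /stake/= lee_fin; case: fc => _ + _; apply.
Qed.

Lemma wealth_ge0 m x : 1 <= m -> 0 <= x -> 0 <= wealth f c m x.
Proof.
by move=> m1 x0; rewrite adde_ge0 ?reserve_ge0// mule_ge0// stake_ge0.
Qed.

Lemma wealth_pinfty x : 0 <= x -> wealth f c +oo x = +oo.
Proof. by move=> x0; rewrite /wealth /reserve /stake/= mul0e adde0. Qed.

Lemma wealth_ge_reserve m x : 1 <= m -> 0 <= x -> reserve f m <= wealth f c m x.
Proof. by move=> m1 x0; rewrite leeDl// mule_ge0// stake_ge0. Qed.

(** Below the maximum, converting more stake than needed into reserve is
    favourable: each unit of stake is exchanged for at least [m >= x]. *)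
Lemma wealth_nondecreasing_max m m' x : 1 <= m -> 0 <= x -> x <= m -> m <= m' ->
  wealth f c m x <= wealth f c m' x.
Proof.
move=> m1 x0 xm; case: m' => [m'||].
- case: m m1 xm => [m m1 xm mm'|_ _|//]; last by rewrite leye_eq.
  case: x x0 xm => [x x0 xm|_|//]; last by rewrite leye_eq.
  rewrite !wealthE !lee_fin in m1 x0 xm mm' *.
  have cc := reserve_pair_nonincreasing fc m1 mm'.
  have [_ _ /(_ _ _ m1 mm')/andP[h1 _]] := fc.
  have : (0 <= (m - x) * (c m - c m'))%R by rewrite mulr_ge0// subr_ge0.
  by lra.
- by move=> _; rewrite wealth_pinfty// leey.
- by move=> mNy; have := le_trans m1 mNy.
Qed.

(** The heart of the matter: after one step the capital is at most what the
    stake chosen before the step would have given.  Reaching a new maximum [x]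
    gives up [c m - c x] units of stake, worth [x] each, for an increase of
    the reserve by at most that amount. *)
Lemma wealth_le_line m x : 1 <= m -> 0 <= x -> x < +oo ->
  wealth f c (maxe m x) x <= reserve f m + stake c m * x.
Proof.
move=> m1 x0 xoo; have [//|mx] := leP x m.
case: x x0 xoo mx => // x x0 _.
case: m m1 => [m m1 mx|_|//]; last by rewrite ltNge leey.
rewrite !lee_fin lte_fin in x0 m1 mx.
have [_ _ /(_ _ _ m1 (ltW mx))/andP[_ h1]] := fc.
by rewrite wealthE /reserve/stake/= -EFinM -EFinD lee_fin; lra.
Qed.

(** An underestimate [m] of the true maximum [m'] by at most a factor [l] is
    compensated by scaling the play by [l]. *)
Lemma wealth_le_scale (l : R) m m' x : (1 <= l)%R -> 1 <= m -> 0 <= x ->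
  x <= m' -> 1 <= m' -> m' <= l%:E * m ->
  wealth f c m' x <=
  wealth (fun m => f (l * m))%R (fun m => l * c (l * m))%R m x.
Proof.
move=> l1 m1 x0 xm' m1' m'm; have l0 : (0 < l)%R by lra.
case: m m1 m'm => [m m1 m'm|_ _|//]; last first.
  by rewrite /wealth /reserve /stake/= mul0e adde0 leey.
case: m' xm' m1' m'm => [m'|_ _|//]; last by rewrite leye_eq.
case: x x0 => [x x0|_|//]; last by rewrite leye_eq.
move=> xm' m1' m'm.
have := wealth_nondecreasing_max m1' x0 xm' m'm.
rewrite !wealthE !lee_fin in m1 x0 xm' m1' m'm *.
have c0 : (0 <= c (l * m))%R.
  by case: fc => _ + _; apply; rewrite mulr_ege1.
have : (0 <= (l - 1) * (c (l * m) * x))%R.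
  by rewrite mulr_ge0 ?subr_ge0// mulr_ge0.
by lra.
Qed.

End pair.
End wealth.

Section wealth_measurable.
Context {d : measure_display} {T : measurableType d} {R : realType}.
Variables (f c : R -> R).
Hypothesis fc : reserve_pair f c.
Variables (m : T -> \bar R).
Hypothesis mm : measurable_fun setT m.
Hypothesis m1 : forall w, 1 <= m w.

(* The hypothesis on g truncates at 1 because reserve and stake are monotone
   only on [1, oo[. *)
Let measurable_fin (g : R -> R) (a : \bar R) :
  measurable_fun setT (fun r : R => g (Num.max 1 r))%R ->
  measurable_fun setT
    (fun w => if m w \is a fin_num then (g (fine (m w)))%:E else a).
Proof.
move=> mg.
rewrite (_ : (fun w => _) =
  fun w => if m w \is a fin_num then (g (Num.max 1 (fine (m w))))%:E else a)%R.
  apply: measurable_fun_ifT => //=.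
    by apply: (measurable_fun_bool true); exact: emeasurable_fin_num.
  apply/measurable_EFinP.
  apply: (measurableT_comp mg).
  exact: measurableT_comp.
apply/funext => w; have := m1 w; case: (m w) => [r|//|//].
by rewrite lee_fin => r1/=; rewrite max_r.
Qed.

Lemma measurable_reserve : measurable_fun setT (fun w => reserve f (m w)).
Proof.
apply: measurable_fin; apply: nondecreasing_measurable => // x y xy.
apply: (reserve_pair_nondecreasing fc); first by rewrite le_max lexx.
by rewrite ge_max !le_max lexx xy orbT.
Qed.

Lemma measurable_stake : measurable_fun setT (fun w => stake c (m w)).
Proof.
apply: measurable_fin; apply: nonincreasing_measurable => // x y xy.
apply: (reserve_pair_nonincreasing fc); first by rewrite le_max lexx.
by rewrite ge_max !le_max lexx xy orbT.
Qed.

Lemma measurable_wealth x : measurable_fun setT x ->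
  measurable_fun setT (fun w => wealth f c (m w) (x w)).
Proof.
move=> mx; apply: emeasurable_funD; first exact: measurable_reserve.
by apply: emeasurable_funM => //; exact: measurable_stake.
Qed.

End wealth_measurable.

Section right_limits.
Context {R : realType}.

Lemma cvg_right_continuous (f : R -> R) (m : R) (I : Type) (F : set_system I)
    (FF : Filter F) (u : I -> R) :
  f y @[y --> m^'+] --> f m -> u x @[x --> F] --> m ->
  (\forall x \near F, (m <= u x)%R) -> f (u x) @[x --> F] --> f m.
Proof.
move=> /cvgrPdist_lt fm um mu; apply/cvgrPdist_lt => e e0.
have [d /= d0 fd] := fm _ e0.
have ud : \forall x \near F, (`|m - u x| < d)%R.
  by move/cvgrPdist_lt : um; exact.
apply: filterS2 mu ud => x; rewrite le_eqVlt => /orP[/eqP<-|mux] ux.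
  by rewrite subrr normr0.
exact: fd.
Qed.

(** On [m >= 1] the increments of [c] are dominated by those of [f]. *)
Lemma stake_right_continuous (f c : R -> R) : reserve_pair f c ->
  right_continuous_from1 f -> right_continuous_from1 c.
Proof.
move=> fc rf m m1; have /cvgrPdist_lt fm := rf _ m1; apply/cvgrPdist_lt => e e0.
have near_m : \forall y \near m^'+, (m < y)%R by exact: nbhs_right_gt.
apply: filterS2 near_m (fm _ e0) => y /ltW my.
have cc := reserve_pair_nonincreasing fc m1 my.
have ff := reserve_pair_nondecreasing fc m1 my.
have [_ _ /(_ _ _ m1 my)/andP[h _]] := fc.
rewrite (@ler0_norm _ (f m - f y)%R) ?subr_le0//.
rewrite (@ger0_norm _ (c m - c y)%R) ?subr_ge0//.
have : (0 <= (m - 1) * (c m - c y))%R by rewrite mulr_ge0// subr_ge0.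
by lra.
Qed.

Lemma wealth_scale_homo (f c : R -> R) (l l' : R) (m x : \bar R) :
  reserve_pair f c -> (1 <= l)%R -> (l <= l')%R -> 1 <= m -> 0 <= x -> x <= m ->
  wealth (fun m => f (l * m))%R (fun m => l * c (l * m))%R m x <=
  wealth (fun m => f (l' * m))%R (fun m => l' * c (l' * m))%R m x.
Proof.
move=> fc l1 ll' m1 x0 xm.
case: m m1 xm => [m m1 xm|_ _|//]; last first.
  by rewrite /wealth/reserve/stake/= !mul0e adde0.
case: x x0 xm => [x x0 xm|_|//]; last by rewrite leye_eq.
rewrite !wealthE !lee_fin in m1 x0 xm *.
have l0 : (0 <= l)%R by lra.
have m0 : (0 <= m)%R by lra.
have lm1 : (1 <= l * m)%R by rewrite mulr_ege1.
have lml'm : (l * m <= l' * m)%R by rewrite ler_wpM2r.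
have cc := reserve_pair_nonincreasing fc lm1 lml'm.
have [_ c0 /(_ _ _ lm1 lml'm)/andP[h _]] := fc.
have : (0 <= (l * (m - x)) * (c (l * m) - c (l' * m)))%R.
  by rewrite !mulr_ge0 ?subr_ge0.
have : (0 <= (l' - l) * (c (l' * m) * x))%R.
  by rewrite !mulr_ge0 ?subr_ge0// c0// (le_trans lm1).
by lra.
Qed.

End right_limits.

(** * The capital along finitely many times *)
Section wealth_step.
Context {d : measure_display} {T : measurableType d} {R : realType}.
Variables (P : {measure set T -> \bar R}) (f c : R -> R).
Hypothesis fc : reserve_pair f c.

(** [m], [x] are the maximum and the value before the step, [y] is the value
    after it.  The bound of [wealth_le_line] is integrated, and the slope
    [stake c m] is the weight of [le_integral_weighted].  That bound fails at
    [y = +oo] when the stake vanishes, whence the integrability of [y]. *)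
Lemma wealth_step (G : set (set T)) (m x y : T -> \bar R) (A : set T) :
  is_sub_sigma_algebra G ->
  measurable_wrt G m -> (forall w, 1 <= m w) ->
  measurable_wrt G x -> (forall w, 0 <= x w) ->
  P.-integrable setT y -> (forall w, 0 <= y w) ->
  (forall B, G B -> \int[P]_(w in B) y w <= \int[P]_(w in B) x w) ->
  G A ->
  \int[P]_(w in A) wealth f c (maxe (m w) (y w)) (y w) <=
  \int[P]_(w in A) wealth f c (m w) (x w).
Proof.
move=> sG mm m1 mx x0 iy y0 yx GA.
have mA := sub_sigma_measurable sG GA.
have mmT := measurable_wrt_fun sG mm.
have mxT := measurable_wrt_fun sG mx.
have myT : measurable_fun setT y by case/integrableP: iy.
have mr := measurable_reserve fc mmT m1.
have ms := measurable_stake fc mmT m1.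
have max1 w : 1 <= maxe (m w) (y w) by rewrite le_max m1.
have s0 w : 0 <= stake c (m w) by rewrite (stake_ge0 fc).
have r0 w : 0 <= reserve f (m w) by rewrite (reserve_ge0 fc).
have lineE z : measurable_fun setT z -> (forall w, 0 <= z w) ->
    \int[P]_(w in A) (reserve f (m w) + stake c (m w) * z w) =
    \int[P]_(w in A) reserve f (m w) + \int[P]_(w in A) (stake c (m w) * z w).
  move=> mz z0; rewrite ge0_integralD//.
  - exact: measurable_funTS.
  - by move=> w _; rewrite mule_ge0.
  - by apply: measurable_funTS; exact: emeasurable_funM.
apply: (@le_trans _ _
    (\int[P]_(w in A) (reserve f (m w) + stake c (m w) * y w))).
  apply: ae_ge0_le_integral => //.
  - by move=> w _; rewrite (wealth_ge0 fc).
  - apply: measurable_funTS; apply: measurable_wealth => //.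
    exact: measurable_maxe.
  - by move=> w _; rewrite adde_ge0// mule_ge0.
  - apply: measurable_funTS; apply: emeasurable_funD => //.
    exact: emeasurable_funM.
  - have := integrable_ae measurableT iy; apply: filterS => w yfin _.
    by apply: wealth_le_line => //; rewrite ltey_eq yfin.
rewrite lineE// [leRHS]lineE// leeD2l//.
apply: (le_integral_weighted sG) => //.
apply/(measurable_wrtP sG).
by apply: (measurable_stake fc) => //; exact/measurable_wrtP.
Qed.

End wealth_step.

(** * Reduction of the running supremum to countably many times *)
Section exhaustion.
Context {d : measure_display} {T : measurableType d} {R : realType}.
Variables (P : {measure set T -> \bar R}).

(** Both for the maximal inequality and for the passage from grids to
    continuous time, an event is exhausted by those on which some member of a
    countable family of times is good enough. *)
Lemma integral_le_exhaust (E : (set T)^nat) (A : set T) (g : T -> \bar R) C :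
  (forall n, measurable (E n)) -> measurable A -> measurable_fun setT g ->
  (forall w, 0 <= g w) ->
  {ae P, forall w, A w -> exists n, E n w} ->
  (forall n, \int[P]_(w in A `&` \bigcup_(i in `I_n) E i) g w <= C) ->
  \int[P]_(w in A) g w <= C.
Proof.
move=> mE mA mg g0 AE gC.
pose D n := A `&` \bigcup_(i in `I_n) E i.
have mD n : measurable (D n).
  by apply: measurableI => //; apply: bigcup_measurable.
have ndD : nondecreasing_seq D.
  move=> n m nm; rewrite subsetEset => w [Aw [i /= ni Ei]].
  by split => //; exists i => //=; exact: leq_trans nm.
have cvgD := ge0_nondecreasing_set_cvg_integral (mu := P) ndD mD
  (fun n => measurable_funTS mg) (fun n w _ => g0 w).
apply: (@le_trans _ _ (\int[P]_(w in \bigcup_n D n) g w)); last first.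
  by apply: (lee_cvg_to cvgD (cvg_cst C)); apply: nearW.
have mU : measurable (\bigcup_n D n) by exact: bigcup_measurable.
rewrite integral_mkcond [leRHS]integral_mkcond.
apply: ae_ge0_le_integral => //.
- by move=> w _; exact: erestrict_ge0.
- by apply/(measurable_restrictT _ _).1 => //; exact: measurable_funTS.
- by move=> w _; exact: erestrict_ge0.
- by apply/(measurable_restrictT _ _).1 => //; exact: measurable_funTS.
apply: filterS AE => w AE _; rewrite !patchE.
case: ifPn => [|_]; last by case: ifPn.
rewrite inE => Aw; case: (AE Aw) => n Enw.
rewrite mem_set//; exists n.+1 => //; split => //; by exists n => /=.
Qed.

End exhaustion.

Section time_grid.
Context {R : realType}.
Variable tm : time_model.
Local Notation time := (@time_set R tm).

Definition time_enum (i : nat) : R :=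
  match tm with
  | DiscreteTime => i%:R
  | ContinuousTime => ratr (odflt 0%R (unpickle i))
  end.

(** Clipping a fixed enumeration of the naturals, or of the rationals, to the
    interval from [s] to [t] treats both time models at once.  All values are
    valid times, and the end point [t] is among them. *)
Definition clip_time (s t : R) (i : nat) : R :=
  Num.min (Num.max s (time_enum i)) t.

Lemma time0 : time (0 : R)%R.
Proof. by rewrite /time_set; case: tm => //=; exists 0%N. Qed.

Lemma time_ge0 t : time t -> (0 <= t)%R.
Proof. by rewrite /time_set; case: tm => //= -[n _ <-]. Qed.

Lemma clip_time_time s t i : time s -> time t -> time (clip_time s t i).
Proof.
move=> hs ht; rewrite /clip_time.
have [si|_] := leP s (time_enum i); case: leP => // _.
move: si hs; rewrite /time_set /time_enum; case: tm => /= si.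
  by move=> _; exists i.
by move=> s0; apply: le_trans s0 si.
Qed.

Lemma clip_time_ge s t i : (s <= t)%R -> (s <= clip_time s t i)%R.
Proof. by move=> st; rewrite le_min le_max lexx. Qed.

Lemma clip_time_le s t i : (clip_time s t i <= t)%R.
Proof. by rewrite ge_min lexx orbT. Qed.

(** [t] is appended so that the grid ends there even for [n = 0]. *)
Definition time_grid (s t : R) (n : nat) : seq R :=
  rcons (sort <=%R [seq clip_time s t i | i <- iota 0 n]) t.

Lemma last_time_grid s t n : last s (time_grid s t n) = t.
Proof. by rewrite last_rcons. Qed.

Lemma mem_time_grid s t n i : (i < n)%N -> clip_time s t i \in time_grid s t n.
Proof.
move=> i_n; rewrite mem_rcons in_cons mem_sort; apply/orP; right.
by apply/mapP; exists i => //; rewrite mem_iota.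
Qed.

Lemma time_grid_time s t n : time s -> time t ->
  {in time_grid s t n, forall r, time r}.
Proof.
move=> hs ht r; rewrite mem_rcons in_cons mem_sort.
move=> /orP[/eqP->//|/mapP[i _ ->]].
exact: clip_time_time.
Qed.

Lemma path_time_grid s t n : (s <= t)%R -> path <=%R s (time_grid s t n).
Proof.
move=> st; rewrite rcons_path path_sortedE; last exact: le_trans.
have inst r : r \in sort <=%R [seq clip_time s t i | i <- iota 0 n] ->
    (s <= r <= t)%R.
  by rewrite mem_sort => /mapP[i _ ->]; rewrite clip_time_ge// clip_time_le.
rewrite sort_sorted ?andbT; last exact: le_total.
apply/andP; split; first by apply/allP => r /inst/andP[].
by have := mem_last s (sort <=%R [seq clip_time s t i | i <- iota 0 n]);
  rewrite in_cons => /orP[/eqP->//|/inst/andP[]].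
Qed.

End time_grid.

Section running_sup.
Context {d : measure_display} {T : measurableType d} {R : realType}.
Variables (tm : time_model) (X : R -> T -> \bar R).
Local Notation time := (@time_set R tm).
Local Notation M := (running_sup tm X).

Definition regular_path w := tm = ContinuousTime ->
  forall t : R, (0 <= t)%R -> X s w @[s --> t^'+] --> X t w.

Lemma running_sup_ge1 t w : 1 <= M t w.
Proof. by rewrite le_max lexx. Qed.

Lemma running_sup_ge s t w : time s -> (s <= t)%R -> X s w <= M t w.
Proof.
move=> hs st; rewrite le_max; apply/orP; right.
by apply: ereal_sup_ubound; exists s.
Qed.

Lemma running_sup_homo s t w : (s <= t)%R -> M s w <= M t w.
Proof.
move=> st; rewrite ge_max running_sup_ge1/=.
apply: ge_ereal_sup => _ [r [hr rs] <-].
by apply: running_sup_ge => //; exact: le_trans st.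
Qed.

Lemma running_sup0 w : M 0 w = maxe 1 (X 0 w).
Proof.
rewrite /running_sup (_ : [set _ | _ in _] = [set X 0 w]) ?ereal_sup1//.
apply/seteqP; split=> [_ [r [/time_ge0 r0 r0'] <-]|_ ->].
  by congr (X _ w); apply/le_anti/andP.
by exists 0%R => //; split; [exact: time0|exact: lexx].
Qed.

(** A value of [X] above [y] at some time persists on a right neighbourhood,
    which contains a rational. *)
Lemma running_sup_approx s t w y : regular_path w ->
  time s -> time t -> (s <= t)%R -> y < M t w ->
  exists i, y < maxe (M s w) (X (clip_time tm s t i) w).
Proof.
move=> rw hs ht st.
rewrite lt_max => /orP[y1|/ereal_sup_gt[_ [r [hr rt] <-] yr]].
  by exists 0%N; rewrite lt_max (lt_le_trans y1 (running_sup_ge1 s w)).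
have [rs|sr] := leP r s.
  by exists 0%N; rewrite lt_max (lt_le_trans yr (running_sup_ge w hr rs)).
suff [i yi] : exists i, y < X (clip_time tm s t i) w.
  by exists i; rewrite lt_max yi orbT.
move: rw rt hr ht hs; rewrite /= /regular_path /clip_time /time_enum.
case: (tm) => /= rw rt hr ht s0.
  case: hr => n _ rE; exists n.
  by rewrite rE max_r ?min_l// ltW.
have ratE q : (s < ratr q)%R ->
    Num.min (Num.max s (ratr (odflt 0%R (unpickle (pickle q))))) t =
    Num.min (ratr q : R) t.
  by move=> sq; rewrite pickleK/= max_r// ltW.
move: rt; rewrite le_eqVlt => /orP[/eqP rt|rt].
  have [q /andP[tq _]] : exists q, (t < ratr q < t + 1)%R.
    have /rat_in_itvoo[q] : (t < t + 1)%R by lra.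
    by rewrite in_itv/=; exists q.
  exists (pickle q); rewrite ratE ?min_r -?rt//; last 2 first.
  - by rewrite rt ltW.
  - by rewrite -rt in tq; exact: lt_trans tq.
have y_near : \forall q \near r^'+, y < X q w.
  have /(_ [set z | y < z]) := rw erefl r hr; apply.
  apply: open_nbhs_nbhs; split => //.
  exact: open_ereal_gt_ereal.
have t_near : \forall q \near r^'+, (q < t)%R by exact: nbhs_right_lt.
have [e e0 re] : exists2 e : R, (0 < e)%R &
    forall q, (r < q < r + e)%R -> (q < t)%R /\ y < X q w.
  have [e /= e0 re] := filterI y_near t_near.
  exists e => // q /andP[rq qe]; have [] := re q => //=.
  by rewrite distrC gtr0_norm ?subr_gt0// ltrBlDl.
have /rat_in_itvoo[q] : (r < r + e)%R by lra.
rewrite in_itv/= => qre; have [qt yq] := re _ qre; case/andP: qre => rq _.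
by exists (pickle q); rewrite ratE ?(lt_trans sr)// min_l// ltW.
Qed.

End running_sup.

(** * The capital driven by a test supermartingale *)
Section test_supermartingale.
Context {d : measure_display} {T : measurableType d} {R : realType}.
Variables (P : probability T R) (tm : time_model) (X : R -> T -> \bar R).
Variable (F : R -> set (set T)).
Hypothesis Xtest : test_supermartingale P tm X F.
Local Notation time := (time_set tm).

Lemma test_supermartingale_sub_sigma t : time t -> is_sub_sigma_algebra (F t).
Proof. by case: Xtest => -[[+ _ _] _ _ _] _ _; apply. Qed.

Let F_homo s t A : time s -> time t -> (s <= t)%R -> F s A -> F t A.
Proof.
move=> hs ht; rewrite le_eqVlt => /orP[/eqP->//|st].
by case: Xtest => -[[_ + _] _ _ _] _ _; move/(_ _ _ hs ht st); apply.
Qed.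

Lemma test_supermartingale_adapted t : time t -> measurable_wrt (F t) (X t).
Proof. by case: Xtest => -[_ /(_ t) + _ _] _ _ => /[apply] -[]. Qed.

Let iX t : time t -> P.-integrable setT (X t).
Proof. by case: Xtest => -[_ /(_ t) + _ _] _ _ => /[apply] -[]. Qed.

Lemma test_supermartingale_ge0 t w : time t -> 0 <= X t w.
Proof. by case: Xtest => _ + _ => /[apply]; exact. Qed.

Local Notation sF := test_supermartingale_sub_sigma.
Local Notation mX := test_supermartingale_adapted.
Local Notation X0 := test_supermartingale_ge0.

Let mXT t : time t -> measurable_fun setT (X t).
Proof. by move=> /iX/integrableP[]. Qed.

Lemma test_supermartingale_integral_le s t A : time s -> time t -> (s <= t)%R ->
  F s A -> \int[P]_(w in A) X t w <= \int[P]_(w in A) X s w.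
Proof.
move=> hs ht; rewrite le_eqVlt => /orP[/eqP->//|st] FA.
case: (Xtest) => -[_ _ /(_ _ _ hs ht st)[Z ZE ZX] _] _ _.
apply: (cond_expectation_integral_le (sF hs) ZE ZX) => //; first exact: mXT.
by move=> w; exact: X0.
Qed.

(** A left fold, so that a step of the induction on the grid replaces the
    initial maximum [m] by its maximum with the first value. *)
Definition grid_sup (m : T -> \bar R) (rs : seq R) (w : T) : \bar R :=
  foldl (fun a r => maxe a (X r w)) (m w) rs.

Lemma measurable_grid_sup m rs : measurable_fun setT m ->
  {in rs, forall r, time r} -> measurable_fun setT (grid_sup m rs).
Proof.
rewrite /grid_sup; elim: rs m => //= r rs IH m mm rst.
apply: (IH (fun w => maxe (m w) (X r w))).
  by apply: measurable_maxe => //; apply: mXT; apply: rst; rewrite mem_head.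
by move=> q qrs; apply: rst; rewrite in_cons qrs orbT.
Qed.

Lemma grid_sup_ge m rs w : m w <= grid_sup m rs w.
Proof.
rewrite /grid_sup; elim: rs (m w) => //= r rs IH a.
by apply: le_trans (IH _); rewrite le_max lexx.
Qed.

Lemma grid_sup_ge_mem m rs w r : r \in rs -> X r w <= grid_sup m rs w.
Proof.
rewrite /grid_sup; elim: rs (m w) => //= q rs IH a.
rewrite in_cons => /orP[/eqP->|/IH//].
apply: le_trans (@grid_sup_ge (fun _ => maxe a (X q w)) rs w).
by rewrite le_max lexx orbT.
Qed.

(** Induction on the grid, the initial maximum being arbitrary: after the
    first step it has absorbed the value reached there. *)
Lemma wealth_grid f c rs s m A : reserve_pair f c ->
  time s -> path <=%R s rs -> {in rs, forall r, time r} ->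
  measurable_wrt (F s) m -> (forall w, 1 <= m w) -> F s A ->
  \int[P]_(w in A) wealth f c (grid_sup m rs w) (X (last s rs) w) <=
  \int[P]_(w in A) wealth f c (m w) (X s w).
Proof.
move=> fc; rewrite /grid_sup; elim: rs s m => //= r rs IH s m hs.
move=> /andP[sr rrs] rst mm m1 FA.
have hr : time r by apply: rst; rewrite mem_head.
have mm' : measurable_wrt (F r) m.
  by move=> B mB; apply: (F_homo hs hr sr); exact: mm.
apply: (@le_trans _ _
    (\int[P]_(w in A) wealth f c (maxe (m w) (X r w)) (X r w))).
  apply: (IH r (fun w => maxe (m w) (X r w))) => //.
  - by move=> q qrs; apply: rst; rewrite in_cons qrs orbT.
  - apply/(measurable_wrtP (sF hr)); apply: measurable_maxe;
      apply/(measurable_wrtP (sF hr)) => //; exact: mX.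
  - by move=> w; rewrite le_max m1.
  - exact: F_homo FA.
apply: (wealth_step fc (sF hs)) => //; last 1 first.
- by move=> B FB; exact: test_supermartingale_integral_le.
- exact: mX.
- by move=> w; exact: X0.
- exact: iX.
- by move=> w; exact: X0.
Qed.


Local Notation M := (running_sup tm X).

Lemma regular_path_ae : {ae P, forall w, regular_path tm X w}.
Proof.
case: (Xtest) => -[_ _ _ rc] _ _; rewrite /regular_path; case: tm rc => rc.
  exact: aeW.
by apply: filterS (rc erefl) => w rw _ t t0; exact: rw.
Qed.

Let complete_F t A : tm = ContinuousTime -> time t -> P.-negligible A -> F t A.
Proof.
move=> tmE ht; case: (Xtest) => -[[_ _ /(_ tmE) uc] _ _ _] _ _.
by have [+ _] := uc t (time_ge0 ht); apply.
Qed.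

(* A version of the running supremum over countably many times, hence
   measurable.  In continuous time the difference is absorbed by the
   completeness of the filtration. *)
Let sup_enum t w : \bar R :=
  maxe (M 0%R w) (esups (fun i => X (clip_time tm 0 t i) w) 0%N).

Let sup_enumE t w : time t -> regular_path tm X w -> M t w = sup_enum t w.
Proof.
move=> ht rw; have t0 := time_ge0 ht; apply/le_anti/andP; split; last first.
  rewrite ge_max running_sup_homo//=; apply: ge_ereal_sup => _ [i _ <-].
  apply: running_sup_ge; first exact: clip_time_time (time0 _) ht.
  exact: clip_time_le.
rewrite leNgt; apply/negP => /(running_sup_approx rw (time0 tm) ht t0)[i].
apply/negP; rewrite -leNgt ge_max; apply/andP; split.
  by rewrite /sup_enum le_max lexx.
rewrite /sup_enum le_max; apply/orP; right.
by apply: ereal_sup_ubound; exists i.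
Qed.

Let mX_le s t : time s -> time t -> (s <= t)%R -> measurable_wrt (F t) (X s).
Proof. by move=> hs ht st B mB; apply: (F_homo hs ht st); exact: mX. Qed.

Let mM0 t : time t -> measurable_wrt (F t) (M 0%R).
Proof.
move=> ht; rewrite (_ : M 0%R = fun w => maxe 1 (X 0%R w)); last first.
  by apply/funext => w; exact: running_sup0.
apply/(measurable_wrtP (sF ht)); apply: measurable_maxe => //.
by apply/(measurable_wrtP (sF ht)); apply: mX_le (time0 _) ht (time_ge0 ht).
Qed.

Let msup_enum t : time t -> measurable_wrt (F t) (sup_enum t).
Proof.
move=> ht; apply/(measurable_wrtP (sF ht)); apply: measurable_maxe.
  by apply/(measurable_wrtP (sF ht)); exact: mM0.
apply: measurable_fun_esups => i; apply/(measurable_wrtP (sF ht)).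
apply: mX_le (clip_time_time i (time0 _) ht) ht _; exact: clip_time_le.
Qed.

Lemma measurable_running_sup t : time t -> measurable_wrt (F t) (M t).
Proof.
move=> ht; have [tmE|tmE] := pselect (tm = ContinuousTime); last first.
  rewrite (_ : M t = sup_enum t); first exact: msup_enum.
  by apply/funext => w; exact: sup_enumE.
have neg : P.-negligible [set w | M t w <> sup_enum t w].
  have := regular_path_ae; apply: filterS => w /(sup_enumE ht).
  by [].
move=> B mB; rewrite -(g_sigma_measurableE (sF ht)).
pose N := [set w | M t w <> sup_enum t w].
have FN A : A `<=` N -> measurable (A : set (g_sigma_algebraType (F t))).
  move=> AN; rewrite (g_sigma_measurableE (sF ht)); apply: complete_F => //.
  exact: negligibleS neg.
rewrite (_ : _ @^-1` _ = ((sup_enum t @^-1` B) `\` N) `|` (M t @^-1` B `&` N)).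
  apply: measurableU; last by apply: FN => w [].
  apply: measurableD; last exact: FN.
  by rewrite (g_sigma_measurableE (sF ht)); exact: msup_enum.
apply/seteqP; split => w /=.
  have [ME|MN] := pselect (M t w = sup_enum t w); last by right.
  by rewrite ME => Bw; left; split.
by case=> [[Bw /contrapT ->]|[]].
Qed.

Let mM t : time t -> measurable_fun setT (M t).
Proof.
by move=> ht; apply/(measurable_wrt_fun (sF ht))/measurable_running_sup.
Qed.

(** The start is a step from maximum 1 and value 1 to [X 0], in accordance with
    the convention that X is 1 at negative times. *)
Lemma initial_wealth f c : reserve_pair f c ->
  \int[P]_w wealth f c (M 0%R w) (X 0%R w) <= (f 1 + c 1)%:E.
Proof.
move=> fc; have h0 : time (0%R : R) := time0 tm.
have [f0 c0 _] := fc.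
have c1 : (0 <= c 1)%R by apply: c0.
have f1 : (0 <= f 1)%R by apply: f0.
apply: (@le_trans _ _ (\int[P]_w ((f 1)%:E + (c 1)%:E * X 0%R w))).
  apply: ae_ge0_le_integral => //.
  - by move=> w _; rewrite (wealth_ge0 fc) ?running_sup_ge1 ?X0.
  - apply: measurable_wealth => //; [exact: mM| |exact: mXT].
    by move=> w; exact: running_sup_ge1.
  - by move=> w _; rewrite adde_ge0// mule_ge0 ?X0// lee_fin.
  - apply: emeasurable_funD => //; apply: emeasurable_funM => //; exact: mXT.
  - have := integrable_ae measurableT (iX h0); apply: filterS => w Xfin _.
    rewrite running_sup0.
    apply: (wealth_le_line fc (m := 1)) => //; first exact: X0.
    by rewrite ltey_eq Xfin.
rewrite ge0_integralD//; last 2 first.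
- by move=> w _; rewrite mule_ge0 ?X0// lee_fin.
- apply: emeasurable_funM => //; exact: mXT.
have mX0 : measurable_fun setT (X 0%R) by exact: mXT.
rewrite ge0_integralZl//; last by move=> w _; exact: X0.
have -> : \int[P]_(w in setT) (f 1)%:E = (f 1)%:E.
  have := integral_cst P measurableT (f 1)%:E => /= ->.
  by rewrite probability_setT mule1.
rewrite EFinD leeD2l//.
rewrite -[leRHS]mule1 lee_wpmul2l ?lee_fin//.
by case: Xtest.
Qed.

Let measurable_grid_wealth f c s t n : reserve_pair f c -> time s -> time t ->
  measurable_fun setT (fun w =>
    wealth f c (grid_sup (M s) (time_grid tm s t n) w) (X t w)).
Proof.
move=> fc hs ht; apply: measurable_wealth => //.
- by apply: measurable_grid_sup; [exact: mM|exact: time_grid_time].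
- by move=> w; apply: le_trans (running_sup_ge1 tm X s w) _; exact: grid_sup_ge.
- exact: mXT.
Qed.

Let grid_wealth_ge0 f c s t n w : reserve_pair f c -> time s -> time t ->
  0 <= wealth f c (grid_sup (M s) (time_grid tm s t n) w) (X t w).
Proof.
move=> fc hs ht; rewrite (wealth_ge0 fc) ?X0//.
by apply: le_trans (running_sup_ge1 tm X s w) _; exact: grid_sup_ge.
Qed.

Let le_grid_sup s t n i w : (i < n)%N ->
  maxe (M s w) (X (clip_time tm s t i) w) <=
  grid_sup (M s) (time_grid tm s t n) w.
Proof.
by move=> i_n; rewrite ge_max grid_sup_ge/= grid_sup_ge_mem// mem_time_grid.
Qed.

Let grid_integral_le f c s t n A : reserve_pair f c ->
  time s -> time t -> (s <= t)%R -> F s A ->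
  \int[P]_(w in A) wealth f c (grid_sup (M s) (time_grid tm s t n) w) (X t w) <=
  \int[P]_(w in A) wealth f c (M s w) (X s w).
Proof.
move=> fc hs ht st FA; rewrite -{2}(last_time_grid tm s t n).
apply: wealth_grid => //.
- exact: path_time_grid.
- exact: time_grid_time.
- exact: measurable_running_sup.
- by move=> w; exact: running_sup_ge1.
Qed.

Lemma integral_grid_le f c s t n A (D : set T) (g : T -> \bar R) :
  reserve_pair f c -> time s -> time t -> (s <= t)%R -> F s A ->
  measurable D -> D `<=` A ->
  measurable_fun setT g -> (forall w, 0 <= g w) ->
  (forall w, D w ->
    g w <= wealth f c (grid_sup (M s) (time_grid tm s t n) w) (X t w)) ->
  \int[P]_(w in D) g w <= \int[P]_(w in A) wealth f c (M s w) (X s w).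
Proof.
move=> fc hs ht st FA mD DA mg g0 gle.
apply: le_trans (grid_integral_le n fc hs ht st FA).
have mW := measurable_grid_wealth n fc hs ht.
apply: (@le_trans _ _ (\int[P]_(w in D)
    wealth f c (grid_sup (M s) (time_grid tm s t n) w) (X t w))).
  apply: ge0_le_integral => //.
  - exact: measurable_funTS.
  - exact: measurable_funTS.
apply: ge0_subset_integral => //.
- exact: (sub_sigma_measurable (sF hs)).
- exact: measurable_funTS.
- by move=> w _; exact: grid_wealth_ge0.
Qed.

(** For every [l > 1] the pair that cashes in at level [l], moving the whole
    stake into a reserve of [l], gives [l P(M = +oo) <= 1]. *)
Lemma running_sup_fin_ae t : time t -> {ae P, forall w, M t w < +oo}.
Proof.
move=> ht; have h0 : time (0%R : R) := time0 tm; have t0 := time_ge0 ht.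
pose A := [set w | M t w = +oo].
have mA : measurable A.
  by rewrite -[A]setTI; exact: (mM ht measurableT (emeasurable_set1 +oo)).
suff PA0 : P A = 0.
  exists A; split => // w /=; rewrite ltey => /negP; rewrite negbK => /eqP.
  by [].
have lA (l : R) : (1 < l)%R -> l%:E * P A <= 1.
  move=> l1.
  have lpair : reserve_pair (fun m => if (l <= m)%R then l else 0%R)
                            (fun m => if (l <= m)%R then 0%R else 1%R).
    split=> [m _|m _|m m' m1 mm'].
    - by case: ifP => // _; lra.
    - by case: ifP.
    - by case: ifPn; rewrite -?ltNge => h1;
        case: ifPn; rewrite -?ltNge => h2; lra.
  have l1F : (l <= 1)%R = false by rewrite leNgt l1.
  have := initial_wealth lpair; rewrite l1F add0r => init.
  rewrite -integral_cst//.
  pose E i := [set w | l%:E <= maxe (M 0%R w) (X (clip_time tm 0 t i) w)].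
  apply: (@integral_le_exhaust _ _ _ P E) => //.
  - move=> i; rewrite -[E i]setTI; apply: emeasurable_fun_le => //.
    apply: measurable_maxe; first exact: mM.
    by apply: mXT; exact: clip_time_time.
  - by move=> w; rewrite lee_fin; lra.
  - apply: filterS regular_path_ae => w rw Aw.
    have [|i li] := @running_sup_approx _ _ _ tm X 0 t w l%:E rw h0 ht t0.
      by rewrite Aw ltry.
    by exists i; exact: ltW.
  move=> n; apply: le_trans init.
  apply: (@integral_grid_le _ _ 0%R t n setT) => //.
  - exact: (sub_sigmaT (sF h0)).
  - apply: measurableI => //; apply: bigcup_measurable => i _.
    rewrite -[E i]setTI; apply: emeasurable_fun_le => //.
    apply: measurable_maxe; first exact: mM.
    by apply: mXT; exact: clip_time_time.
  - by move=> w; rewrite lee_fin; lra.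
  move=> w [_ [i /= i_n Ei]].
  have lsup := le_trans Ei (le_grid_sup 0%R t w i_n).
  apply: le_trans (wealth_ge_reserve lpair _ (X0 w ht)); last first.
    by apply: le_trans (running_sup_ge1 tm X 0 w) _; exact: grid_sup_ge.
  rewrite /reserve; case: (grid_sup _ _ w) lsup => [r|_|//].
    by rewrite lee_fin /= => ->.
  by rewrite leey.
apply/eqP; rewrite eq_le measure_ge0 andbT leNgt; apply/negP => PA_gt0.
have PAfin : P A \is a fin_num by exact: fin_num_measure.
have p0 : (0 < fine (P A))%R by rewrite fine_gt0// PA_gt0 ltey_eq PAfin.
move: lA; rewrite -(fineK PAfin); set p := fine (P A) in p0 * => lA.
have p20 : (0 < 2 / p)%R by rewrite divr_gt0.
have pE : ((2 + 2 / p) * p = 2 * p + 2)%R by field; rewrite gt_eqF.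
have /lA : (1 < 2 + 2 / p)%R by lra.
by rewrite -EFinM lee_fin pE; lra.
Qed.

(** As [M t] is finite and [l > 1], almost every path has a grid time at which
    [l] times the grid maximum exceeds [M t]; there [wealth_le_scale] applies,
    and [wealth_grid] bounds the scaled capital. *)
Lemma wealth_le_scaled f c (l : R) s t A : reserve_pair f c -> (1 < l)%R ->
  time s -> time t -> (s <= t)%R -> F s A ->
  \int[P]_(w in A) wealth f c (M t w) (X t w) <=
  \int[P]_(w in A) wealth (fun m => f (l * m))%R (fun m => l * c (l * m))%R
     (M s w) (X s w).
Proof.
move=> fc l1 hs ht st FA.
have l1' := ltW l1; have l0 : (0 < l)%R by lra.
have fcl := reserve_pair_scale l1' fc.
pose E i := [set w | M t w <= l%:E * maxe (M s w) (X (clip_time tm s t i) w)].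
have mE i : measurable (E i).
  rewrite -[E i]setTI; apply: emeasurable_fun_le => //; first exact: mM.
  apply: emeasurable_funM => //.
  apply: measurable_maxe; first exact: mM.
  by apply: mXT; exact: clip_time_time.
have mA := sub_sigma_measurable (sF hs) FA.
have mW : measurable_fun setT (fun w => wealth f c (M t w) (X t w)).
  apply: measurable_wealth => //; [exact: mM| |exact: mXT].
  by move=> w; exact: running_sup_ge1.
have W0 w : 0 <= wealth f c (M t w) (X t w).
  by rewrite (wealth_ge0 fc) ?running_sup_ge1 ?X0.
apply: (@integral_le_exhaust _ _ _ P E) => //.
  apply: filterS2 regular_path_ae (running_sup_fin_ae ht) => w rw Mfin _.
  have Mfin' : M t w \is a fin_num.
    by rewrite ge0_fin_numE// (le_trans _ (running_sup_ge1 tm X t w)).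
  have M1 := running_sup_ge1 tm X t w.
  have [|i li] :=
    @running_sup_approx _ _ _ tm X s t w ((l^-1)%:E * M t w) rw hs ht st.
    rewrite lte_pdivrMl// -(fineK Mfin') -EFinM lte_fin.
    rewrite -(fineK Mfin') lee_fin in M1.
    have : (0 < (l - 1) * fine (M t w))%R by rewrite mulr_gt0//; lra.
    by lra.
  by exists i; rewrite /E/= -lee_pdivrMl// ltW.
move=> n; apply: (integral_grid_le (n := n) fcl hs ht st FA) => //.
  by apply: measurableI => //; apply: bigcup_measurable => i _.
move=> w [_ [i /= i_n Ei]].
apply: wealth_le_scale => //.
- by apply: le_trans (running_sup_ge1 tm X s w) _; exact: grid_sup_ge.
- exact: X0.
- exact: running_sup_ge.
- exact: running_sup_ge1.
apply: le_trans Ei _; rewrite lee_wpmul2l ?lee_fin ?(ltW l0)//.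
exact: le_grid_sup.
Qed.

End test_supermartingale.

Section reserve_supermartingale.
Context {d : measure_display} {T : measurableType d} {R : realType}.
Variables (P : probability T R) (tm : time_model) (X : R -> T -> \bar R).
Variable (F : R -> set (set T)).
Hypothesis Xtest : test_supermartingale P tm X F.
Variables (f c : R -> R).
Hypotheses (fc : reserve_pair f c) (rf : right_continuous_from1 f).
Hypothesis fc1 : (f 1 + c 1 <= 1)%R.
Local Notation time := (time_set tm).
Local Notation M := (running_sup tm X).
Local Notation fl l := (fun m => f (l * m))%R.
Local Notation cl l := (fun m => l * c (l * m))%R.

Let sF t : time t -> is_sub_sigma_algebra (F t).
Proof. exact: (test_supermartingale_sub_sigma Xtest). Qed.

Let mX t : time t -> measurable_wrt (F t) (X t).
Proof. exact: (test_supermartingale_adapted Xtest). Qed.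

Let X0 t w : time t -> 0 <= X t w.
Proof. exact: (test_supermartingale_ge0 Xtest). Qed.

Let mwealth g e t : reserve_pair g e -> time t ->
  measurable_wrt (F t) (fun w => wealth g e (M t w) (X t w)).
Proof.
move=> ge ht; apply/(measurable_wrtP (sF ht)); apply: measurable_wealth => //.
- by apply/(measurable_wrtP (sF ht)); exact: (measurable_running_sup Xtest ht).
- by move=> w; exact: running_sup_ge1.
- by apply/(measurable_wrtP (sF ht)); exact: mX.
Qed.

Let mwealthT g e t : reserve_pair g e -> time t ->
  measurable_fun setT (fun w => wealth g e (M t w) (X t w)).
Proof.
by move=> ge ht; apply: (measurable_wrt_fun (sF ht)); exact: mwealth.
Qed.

Let wealth0 g e t w : reserve_pair g e -> time t ->
  0 <= wealth g e (M t w) (X t w).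
Proof. by move=> ge ht; rewrite (wealth_ge0 ge) ?running_sup_ge1 ?X0. Qed.

(* The dominating function for the limit as the factor decreases to 1. *)
Let scaled_integrable t : time t ->
  P.-integrable setT (fun w => wealth (fl 2) (cl 2) (M t w) (X t w)).
Proof.
move=> ht; have h0 : time (0%R : R) := time0 tm.
have le12 : (1 <= 2 :> R)%R by lra.
have lt12 : (1 < 2 :> R)%R by lra.
have fc2 := reserve_pair_scale le12 fc.
apply/integrableP; split; first exact: mwealthT.
under eq_integral do rewrite gee0_abs ?wealth0//.
apply: le_lt_trans (wealth_le_scaled Xtest fc2 lt12 h0 ht (time_ge0 ht) _) _.
  exact: (sub_sigmaT (sF h0)).
apply: le_lt_trans (initial_wealth Xtest (reserve_pair_scale le12 fc2)) _.
exact: ltry.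
Qed.

Let scaled_cvg t w : time t -> M t w < +oo ->
  wealth (fl (1 + k.+1%:R^-1)) (cl (1 + k.+1%:R^-1)) (M t w) (X t w)
    @[k --> \oo] --> wealth f c (M t w) (X t w).
Proof.
move=> ht; have := running_sup_ge1 tm X t w.
have := running_sup_ge X w ht (lexx t); have := X0 w ht.
case: (M t w) => [m|//|//]; case: (X t w) => [x|_|//]; last by rewrite leye_eq.
rewrite wealthE !lee_fin => x0 xm m1 _.
under eq_fun do rewrite wealthE.
apply: cvg_EFin; first exact: nearW.
have lcvg : (1 + k.+1%:R^-1 : R)%R @[k --> \oo] --> (1 : R)%R.
  rewrite -[X in _ --> X]addr0.
  by apply: cvgD; [exact: cvg_cst|exact: cvg_harmonic].
have lmcvg : ((1 + k.+1%:R^-1) * m : R)%R @[k --> \oo] --> m.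
  by rewrite -[X in _ --> X]mul1r; apply: cvgM => //; exact: cvg_cst.
have mlm : \forall k \near \oo, (m <= (1 + k.+1%:R^-1) * m :> R)%R.
  apply: nearW => k; apply: ler_peMl; first exact: le_trans m1.
  by rewrite lerDl invr_ge0 ler0n.
apply: cvgD; first exact: cvg_right_continuous (rf m1) lmcvg mlm.
apply: cvgM; last exact: cvg_cst.
rewrite -[X in _ --> X]mul1r; apply: cvgM => //.
exact: cvg_right_continuous (stake_right_continuous fc rf m1) lmcvg mlm.
Qed.

(** The limit of [wealth_le_scaled] along [l = 1 + 1 / (k + 1)], by dominated
    convergence. *)
Lemma wealth_integral_le s t A : time s -> time t -> (s <= t)%R -> F s A ->
  \int[P]_(w in A) wealth f c (M t w) (X t w) <=
  \int[P]_(w in A) wealth f c (M s w) (X s w).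
Proof.
move=> hs ht st FA; have mA := sub_sigma_measurable (sF hs) FA.
pose l (k : nat) : R := (1 + k.+1%:R^-1)%R.
have l1 k : (1 < l k)%R by rewrite ltrDl invr_gt0 ltr0n.
have l2 k : (l k <= 2)%R.
  by rewrite /l -[leRHS]/(1 + 1)%R lerD2l invf_le1 ?ler1n ?ltr0n.
have fcl k : reserve_pair (fl (l k)) (cl (l k)).
  by apply: reserve_pair_scale => //; exact: ltW.
have [_ _ dc] : [/\ P.-integrable A (fun w => wealth f c (M s w) (X s w)),
    [sequence \int[P]_(w in A)
      `|wealth (fl (l k)) (cl (l k)) (M s w) (X s w) -
        wealth f c (M s w) (X s w)|]_k @ \oo --> 0 &
    [sequence \int[P]_(w in A)
      wealth (fl (l k)) (cl (l k)) (M s w) (X s w)]_k @ \oo -->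
    \int[P]_(w in A) wealth f c (M s w) (X s w)].
  apply: (dominated_convergence mA
    (g := fun w => wealth (fl 2) (cl 2) (M s w) (X s w))).
  - by move=> k; apply: measurable_funTS; exact: mwealthT.
  - by apply: measurable_funTS; exact: mwealthT.
  - apply: filterS (running_sup_fin_ae Xtest hs) => w Mfin _.
    exact: scaled_cvg.
  - by apply: (integrableS measurableT) => //; exact: scaled_integrable.
  - apply: aeW => w k _; rewrite gee0_abs ?wealth0//.
    apply: wealth_scale_homo => //.
    + exact: ltW.
    + exact: running_sup_ge1.
    + exact: X0.
    + exact: running_sup_ge.
apply: (lee_cvg_to (cvg_cst _) dc); apply: nearW => k /=.
exact: (wealth_le_scaled Xtest fc (l1 k) hs ht st FA).
Qed.

(* Right-continuity of the running supremum, in terms of extended reals. *)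
Let running_sup_right_near w (t e : R) : tm = ContinuousTime ->
  regular_path tm X w -> (0 <= t)%R -> (0 < e)%R ->
  \forall s \near t^'+, M t w <= M s w <= M t w + e%:E.
Proof.
move=> tmE rw t0 e0; have ht : time t by rewrite tmE.
have M0 : 0 <= M t w by apply: le_trans (running_sup_ge1 tm X t w).
have [Mfin|] := boolP (M t w \is a fin_num); last first.
  rewrite ge0_fin_numE// ltey negbK => /eqP Moo; near=> s.
  by rewrite running_sup_homo//= Moo ?addye// leey.
have y_near : \forall q \near t^'+, X q w < M t w + e%:E.
  have /(_ [set z | z < M t w + e%:E]) := rw tmE t t0; apply.
  apply: open_nbhs_nbhs; split; first exact: open_ereal_lt_ereal.
  apply: le_lt_trans (running_sup_ge X w ht (lexx t)) _.
  by rewrite lteDl.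
have [/= r r0 tr] := y_near.
near=> s; have ts : (t < s)%R by near: s; exact: nbhs_right_gt.
have sr : (s < t + r)%R by near: s; apply: nbhs_right_lt; rewrite ltrDl.
rewrite running_sup_homo ?(ltW ts)//= ge_max; apply/andP; split.
  by apply: le_trans (running_sup_ge1 tm X t w) _; rewrite leeDl// lee_fin ltW.
apply: ge_ereal_sup => _ [q [hq /= qs] <-]; have [qt|tq] := leP q t.
  apply: le_trans (running_sup_ge X w hq qt) _.
  by rewrite leeDl// lee_fin ltW.
apply/ltW/tr => //=; rewrite ltr0_norm ?subr_lt0// opprB ltrBlDl.
exact: le_lt_trans sr.
Unshelve. all: by end_near. Qed.

Lemma wealth_right_continuous_paths : tm = ContinuousTime ->
  right_continuous_paths P (fun t w => wealth f c (M t w) (X t w)).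
Proof.
move=> tmE; have ht (t : R) : (0 <= t)%R -> time t by rewrite tmE.
have Mfin_ae : {ae P, forall w, forall n : nat, M n%:R w < +oo}.
  by apply: ae_foralln => n; apply: (running_sup_fin_ae Xtest); exact: ht.
apply: filterS2 (regular_path_ae Xtest) Mfin_ae => w rw Mfin t t0.
have Mfin_num (s : R) : (0 <= s)%R -> M s w \is a fin_num.
  move=> s0; rewrite ge0_fin_numE; last first.
    by apply: le_trans (running_sup_ge1 tm X s w).
  have [n sn] : exists n, (s <= n%:R)%R.
    by exists (Num.truncn s).+1; apply/ltW/truncnS_gt.
  by apply: le_lt_trans (Mfin n); exact: running_sup_homo.
have Xfin (s : R) : (0 <= s)%R -> X s w \is a fin_num.
  move=> s0; rewrite ge0_fin_numE; last exact: (X0 w (ht s s0)).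
  apply: le_lt_trans (running_sup_ge X w (ht s s0) (lexx s)) _.
  by rewrite ltey_eq Mfin_num.
pose m s := fine (M s w); pose x s := fine (X s w).
have t_near : \forall s \near t^'+, (t <= s)%R.
  by apply: filterS (nbhs_right_gt t) => s /ltW.
have xcvg : x s @[s --> t^'+] --> x t.
  apply: fine_cvg; rewrite (fineK (Xfin t t0)); exact: rw.
have m_ge : \forall s \near t^'+, (m t <= m s)%R.
  apply: filterS t_near => s ts; have s0 := le_trans t0 ts.
  by rewrite fine_le ?Mfin_num// running_sup_homo.
have mcvg : m s @[s --> t^'+] --> m t.
  apply/cvgrPdist_le => e e0.
  have := running_sup_right_near tmE rw t0 e0.
  apply: filterS2 t_near => s /(le_trans t0) s0 /andP[].
  rewrite -(fineK (Mfin_num _ t0)) -(fineK (Mfin_num _ s0)) -EFinD !lee_fin.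
  by rewrite -/(m s) -/(m t) => h1 h2; rewrite ler0_norm; lra.
have mt1 : (1 <= m t)%R.
  by rewrite -lee_fin fineK ?Mfin_num//; exact: running_sup_ge1.
have WE (s : R) : (0 <= s)%R ->
    (f (m s) + c (m s) * x s)%:E = wealth f c (M s w) (X s w).
  by move=> s0; rewrite -wealthE !fineK ?Mfin_num ?Xfin.
rewrite -(WE t t0).
apply: (cvg_trans (G := (f (m s) + c (m s) * x s)%:E @[s --> t^'+])).
  apply: near_eq_cvg; apply: filterS t_near => s /(le_trans t0); exact: WE.
apply: cvg_EFin; first exact: nearW.
apply: cvgD; first exact: cvg_right_continuous (rf mt1) mcvg m_ge.
apply: cvgM => //.
exact: cvg_right_continuous (stake_right_continuous fc rf mt1) mcvg m_ge.
Qed.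

Lemma wealth_test_supermartingale :
  test_supermartingale P tm (fun t w => wealth f c (M t w) (X t w)) F.
Proof.
have h0 : time (0%R : R) := time0 tm.
have init : \int[P]_w wealth f c (M 0%R w) (X 0%R w) <= 1.
  by apply: le_trans (initial_wealth Xtest fc) _; rewrite lee_fin.
have fin t : time t -> \int[P]_w wealth f c (M t w) (X t w) < +oo.
  move=> ht; apply: le_lt_trans (wealth_integral_le h0 ht (time_ge0 ht) _) _.
    exact: (sub_sigmaT (sF h0)).
  exact: le_lt_trans init (ltry _).
split=> //; last by move=> t ht w; exact: wealth0.
split.
- by case: Xtest => -[].
- move=> t ht; split; first exact: mwealth.
  apply/integrableP; split; first exact: mwealthT.
  by under eq_integral do rewrite gee0_abs ?wealth0//; exact: fin.
- move=> s t hs ht st; apply: (cond_expectation_le (sF hs)) => //.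
  + exact: mwealthT.
  + by move=> w; exact: wealth0.
  + exact: mwealth.
  + by move=> w; exact: wealth0.
  + exact: fin.
  + by move=> A FA; apply: wealth_integral_le => //; exact: ltW.
- exact: wealth_right_continuous_paths.
Qed.

Lemma extend_le_wealth g t w : dominates f g -> time t ->
  extend_at_infty g (M t w) <= wealth f c (M t w) (X t w).
Proof.
move=> fg ht; have := running_sup_ge1 tm X t w; have := X0 w ht.
case: (M t w) => [m||//] x0 m1.
  by apply: le_trans (wealth_ge_reserve fc m1 x0); rewrite lee_fin fg.
by rewrite /wealth /reserve /stake/= mul0e adde0 leey.
Qed.

End reserve_supermartingale.

(** * The integral of a calibrator *)
Section calibrator_integral.
Context {R : realType}.
Variable f : R -> R.
Hypothesis f_incr : increasing_nonneg f.

Local Notation I a b :=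
  (\int[lebesgue_measure]_(x in `]a, b]) (f (1 / x)%R)%:E).

Let f0 x : (1 <= x)%R -> (0 <= f x)%R.
Proof. by case: f_incr => + _; apply. Qed.

Let f_homo x y : (1 <= x)%R -> (x <= y)%R -> (f x <= f y)%R.
Proof. by case: f_incr => _; apply. Qed.

Lemma inv_ge1 (x : R) : (0 < x)%R -> (x <= 1)%R -> (1 <= 1 / x)%R.
Proof. by move=> x0 x1; rewrite div1r invf_ge1. Qed.

Lemma measurable_calibrator (a b : R) : (0 <= a)%R -> (b <= 1)%R ->
  measurable_fun `]a, b] (fun x => (f (1 / x)%R)%:E).
Proof.
move=> a0 b1; apply/measurable_EFinP.
apply: (measurable_funS (E := `](0 : R)%R, (1 : R)%R]%classic)) => //.
  by apply: subset_itv; rewrite bnd_simp.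
apply: (eq_measurable_fun (fun x : R => f (Num.max 1 (x^-1)))%R) => [x|].
  rewrite inE/= in_itv/= => /andP[x0 x1].
  by have := inv_ge1 x0 x1; rewrite div1r => x1'; rewrite max_r.
have mf : measurable_fun setT (fun r : R => f (Num.max 1 r))%R.
  apply: nondecreasing_measurable => // x y xy.
  apply: f_homo; first by rewrite le_max lexx.
  by rewrite ge_max !le_max lexx xy orbT.
apply: (measurableT_comp mf).
apply: (measurable_funS (E := `](0 : R)%R, +oo[%classic)) => //.
  by apply: subset_itv; rewrite bnd_simp.
apply: open_continuous_measurable_fun; first exact: interval_open.
move=> x; rewrite inE/= in_itv/= andbT => x0.
by apply: inv_continuous; rewrite gt_eqF.
Qed.

Let calibrator_ge0 (a b x : R) : (0 <= a)%R -> (b <= 1)%R ->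
  x \in `]a, b] -> 0 <= (f (1 / x)%R)%:E.
Proof.
move=> a0 b1; rewrite in_itv/= => /andP[ax xb].
by rewrite lee_fin f0// inv_ge1//; [exact: le_lt_trans ax|exact: le_trans b1].
Qed.

Lemma calibrator_integral_split (a b e : R) :
  (0 <= a)%R -> (a <= b)%R -> (b <= e)%R -> (e <= 1)%R ->
  I a e = I a b + I b e.
Proof.
move=> a0 ab be e1.
have abe : [set` `]a, e]] = [set` `]a, b]] `|` [set` `]b, e]].
  by apply: itv_bndbnd_setU; rewrite bnd_simp.
rewrite {1}abe ge0_integral_setU//.
- by rewrite -abe; exact: measurable_calibrator.
- by move=> x; rewrite -abe; exact: calibrator_ge0.
- rewrite disj_set2E; apply/eqP/seteqP; split => // x /=.
  by rewrite !in_itv/= => -[/andP[_ xb] /andP[+ _]]; rewrite ltNge xb.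
Qed.

Lemma integral_cst_itv (v a b : R) : (a <= b)%R ->
  \int[lebesgue_measure]_(x in `]a, b]) v%:E = (v * (b - a))%:E.
Proof.
move=> ab.
have := integral_cst (@lebesgue_measure R) (measurable_itv `]a, b]) v%:E.
move=> /= ->; rewrite lebesgue_measure_itv/= lte_fin.
move: ab; rewrite le_eqVlt => /orP[/eqP->|->].
  by rewrite ltxx subrr mulr0 mule0.
by rewrite -EFinB EFinM.
Qed.

Lemma calibrator_integral_ge (v a b : R) : (0 <= v)%R ->
  (0 <= a)%R -> (a <= b)%R -> (b <= 1)%R ->
  (forall x, (a < x)%R -> (x <= b)%R -> (v <= f (1 / x))%R) ->
  (v * (b - a))%:E <= I a b.
Proof.
move=> v0 a0 ab b1 vf; rewrite -integral_cst_itv//.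
apply: ge0_le_integral => //.
- exact: measurable_calibrator.
- by move=> x /=; rewrite in_itv/= => /andP[ax xb]; rewrite lee_fin vf.
Qed.

Lemma calibrator_integral_le (v a b : R) : (0 <= v)%R ->
  (0 <= a)%R -> (a <= b)%R -> (b <= 1)%R ->
  (forall x, (a < x)%R -> (x <= b)%R -> (f (1 / x) <= v)%R) ->
  I a b <= (v * (b - a))%:E.
Proof.
move=> v0 a0 ab b1 vf; rewrite -integral_cst_itv//.
apply: ge0_le_integral => //.
- by move=> x; exact: calibrator_ge0.
- exact: measurable_calibrator.
- by move=> x /=; rewrite in_itv/= => /andP[ax xb]; rewrite lee_fin vf.
Qed.

Lemma calibrator_integral_ge0 (a b : R) : (0 <= a)%R -> (b <= 1)%R ->
  0 <= I a b.
Proof. by move=> a0 b1; apply: integral_ge0 => x; exact: calibrator_ge0. Qed.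

Section pair_of_calibrator.
Hypothesis f_le1 : calibrator_integral f <= 1.

Let tail m := fine (I 0%R (1 / m)%R).

Let le_inv (x y : R) : (1 <= x)%R -> (x <= y)%R -> (1 / y <= 1 / x)%R.
Proof.
move=> x1 xy; have x0 : (0 < x)%R by lra.
by rewrite !div1r lef_pV2// posrE// (lt_le_trans x0).
Qed.

Let inv_itv (x : R) : (1 <= x)%R -> (0 <= 1 / x <= 1)%R.
Proof.
move=> x1; have x0 : (0 < x)%R by lra.
by rewrite div1r invr_ge0 (ltW x0)/= invf_le1.
Qed.

Let tailE m : (1 <= m)%R -> I 0%R (1 / m)%R = (tail m)%:E.
Proof.
move=> /inv_itv/andP[m0 m1]; rewrite fineK// ge0_fin_numE; last first.
  exact: calibrator_integral_ge0.
apply: le_lt_trans (ltry 1%R); apply: le_trans f_le1.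
rewrite /calibrator_integral (@calibrator_integral_split 0%R (1 / m)%R 1%R)//.
by rewrite leeDl// calibrator_integral_ge0.
Qed.

Let tail_diff m m' : (1 <= m)%R -> (m <= m')%R ->
  (f m * (1 / m - 1 / m') <= tail m - tail m' <= f m' * (1 / m - 1 / m'))%R.
Proof.
move=> m1 mm'; have m'1 := le_trans m1 mm'.
have /andP[i0 i1] := inv_itv m1; have /andP[i'0 i'1] := inv_itv m'1.
have ii' := le_inv m1 mm'.
have split_tail := @calibrator_integral_split 0%R _ _ (lexx _) i'0 ii' i1.
have Ifin : I (1 / m')%R (1 / m)%R = (tail m - tail m')%:E.
  move: split_tail; rewrite !tailE// EFinB => ->.
  by rewrite addeAC subee// add0e.
have m0 : (0 < m)%R by lra.
have m'0 : (0 < m')%R by lra.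
rewrite -!lee_fin -Ifin; apply/andP; split.
  apply: calibrator_integral_ge => //; first exact: f0.
  move=> x m'x xm; apply: f_homo => //.
  by rewrite ler_pdivlMr ?(le_lt_trans i'0)// mulrC -ler_pdivlMr.
apply: calibrator_integral_le => //; first exact: f0.
move=> x m'x xm; have x0 := le_lt_trans i'0 m'x.
apply: f_homo; first exact: inv_ge1 (le_trans xm i1).
by rewrite ler_pdivrMr// mulrC -ler_pdivrMr// ltW.
Qed.

(** The stake is the tail integral minus the rectangle below it:
    [c m] is the integral of [f (1 / x) - f m] over [0 < x <= 1 / m].  The pair
    inequalities are rectangle bounds for the integral over
    [1 / m' < x <= 1 / m]. *)
Lemma calibrator_reserve_pair :
  exists2 c : R -> R, reserve_pair f c & (f 1 + c 1 <= 1)%R.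
Proof.
exists (fun m => tail m - f m / m)%R; last first.
  rewrite divr1 addrC subrK -lee_fin -tailE//; apply: le_trans f_le1.
  by rewrite divr1.
split=> [//|m m1|m m' m1 mm'].
  have /andP[i0 i1] := inv_itv m1; have m0 : (0 < m)%R by lra.
  rewrite subr_ge0 -lee_fin -tailE//.
  apply: le_trans (calibrator_integral_ge (f0 m1) (lexx 0%R) i0 i1 _).
    by rewrite subr0 div1r.
  move=> x x0 xm; apply: f_homo => //.
  by rewrite ler_pdivlMr// mulrC -ler_pdivlMr.
have m0 : (0 < m)%R by lra.
have m'0 : (0 < m')%R by lra.
have /andP[h1 h2] := tail_diff m1 mm'.
have e1 : (m * (tail m - f m / m - (tail m' - f m' / m')) =
  m * (tail m - tail m') - f m + f m' * (m / m'))%R.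
  by field; rewrite !gt_eqF.
have e2 : (m' * (tail m - f m / m - (tail m' - f m' / m')) =
  m' * (tail m - tail m') - f m * (m' / m) + f m')%R.
  by field; rewrite !gt_eqF.
have := ler_wpM2l (ltW m0) h2; have := ler_wpM2l (ltW m'0) h1.
have -> : (m' * (f m * (1 / m - 1 / m')) = f m * (m' / m) - f m)%R.
  by field; rewrite !gt_eqF.
have -> : (m * (f m' * (1 / m - 1 / m')) = f m' - f m' * (m / m'))%R.
  by field; rewrite !gt_eqF.
rewrite e1 e2 => k1 k2; apply/andP; split; lra.
Qed.

End pair_of_calibrator.

End calibrator_integral.

Section geometric_sum.
Context {R : realType}.
Implicit Types (f : R -> R) (a : R).

(** The lower Riemann sum of [f (1 / x)] on the partition by the points
    [a ^- k]; [upper_geometric_sum] is the upper sum. *)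
Definition geometric_sum f a (n : nat) : R :=
  (\sum_(k < n) f (a ^+ k) * (a ^- k - a ^- k.+1))%R.

Definition upper_geometric_sum f a (n : nat) : R :=
  (\sum_(k < n) f (a ^+ k.+1) * (a ^- k - a ^- k.+1))%R.

Lemma exprN_anti a (k : nat) : (1 < a)%R -> (a ^- k.+1 <= a ^- k)%R.
Proof.
move=> a1; have a0 : (0 < a)%R by lra.
by rewrite lef_pV2 ?posrE ?exprn_gt0// exprS ler_peMl ?exprn_ge0 ?ltW.
Qed.

Lemma exprN_itv a (k : nat) : (1 < a)%R -> (0 < a ^- k <= 1)%R.
Proof.
move=> a1; have a0 : (0 < a)%R by lra.
by rewrite invr_gt0 exprn_gt0//= invf_le1 ?exprn_gt0// exprn_ege1// ltW.
Qed.

(** Cells of a geometric partition shrink by the factor [a], so the upper sum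
    is [a] times the lower sum shifted by one cell. *)
Lemma upper_geometric_sum_le f a n : increasing_nonneg f -> (1 < a)%R ->
  (upper_geometric_sum f a n <= a * geometric_sum f a n.+1)%R.
Proof.
move=> [f0 _] a1; have a0 : (0 < a)%R by lra.
have a00 : a != 0%R by rewrite gt_eqF.
rewrite /geometric_sum big_ord_recl/= mulrDr mulr_sumr.
rewrite -[leLHS]add0r; apply: lerD.
  rewrite mulr_ge0 ?(ltW a0)// mulr_ge0 ?f0// subr_ge0.
  exact: (exprN_anti 0).
rewrite /upper_geometric_sum le_eqVlt; apply/orP; left; apply/eqP.
apply: eq_bigr => k _; rewrite mulrCA; congr (_ * _)%R.
rewrite /bump/= add1n !exprS; have := expf_neq0 k a00.
set b := (a ^+ k)%R => b0.
by field; rewrite a00 b0.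
Qed.

(** Used with [f] the right limit of [g], which is at most [g] at any larger
    point. *)
Lemma le_geometric_sum f g a n : (1 < a)%R ->
  (forall x, (1 <= x)%R -> (f x <= g (a * x))%R) ->
  (geometric_sum f a n <= upper_geometric_sum g a n)%R.
Proof.
move=> a1 fg; apply: ler_sum => k _; apply: ler_wpM2r.
  by rewrite subr_ge0 exprN_anti.
by rewrite exprS fg// exprn_ege1// ltW.
Qed.

Section integral.
Variable f : R -> R.
Hypothesis f_incr : increasing_nonneg f.

Local Notation I a b :=
  (\int[lebesgue_measure]_(x in `]a, b]) (f (1 / x)%R)%:E).

Lemma geometric_sum_le_integral a n : (1 < a)%R ->
  (geometric_sum f a n)%:E <= calibrator_integral f.
Proof.
move=> a1; have a0 : (0 < a)%R by lra.
have [f0 f_homo] := f_incr.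
have /andP[an0 an1] := exprN_itv n a1.
rewrite /calibrator_integral.
rewrite (calibrator_integral_split f_incr (b := a ^- n)%R) ?(ltW an0)//.
apply: le_trans (leeDr _ (calibrator_integral_ge0 f_incr _ an1)) => //.
elim: n {an0 an1} => [|n IH].
  rewrite /geometric_sum big_ord0 (calibrator_integral_ge0 f_incr)//.
  by case/andP: (exprN_itv 0 a1) => /ltW.
have /andP[an0 an1] := exprN_itv n a1.
have /andP[an'0 _] := exprN_itv n.+1 a1.
have an := exprN_anti n a1.
rewrite (calibrator_integral_split f_incr (ltW an'0) an an1 (lexx _)).
rewrite /geometric_sum big_ord_recr/= EFinD addeC leeD//.
have a1n : (1 <= a ^+ n)%R by rewrite exprn_ege1// ltW.
apply: calibrator_integral_ge => //; first exact: f0.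
  exact: ltW.
move=> x ax xa; apply: f_homo => //.
have x0 : (0 < x)%R := lt_trans an'0 ax.
by rewrite ler_pdivlMr// mulrC -ler_pdivlMr ?exprn_gt0// div1r.
Qed.

Let integral_le_upper_sum a n : (1 < a)%R ->
  I (a ^- n)%R 1%R <= (upper_geometric_sum f a n)%:E.
Proof.
move=> a1; have a0 : (0 < a)%R by lra.
have [f0 f_homo] := f_incr.
elim: n => [|n IH].
  by rewrite /upper_geometric_sum big_ord0 expr0 invr1 set_itvoc0 integral_set0.
have /andP[an0 an1] := exprN_itv n a1.
have /andP[an'0 _] := exprN_itv n.+1 a1.
have an := exprN_anti n a1.
rewrite (calibrator_integral_split f_incr (ltW an'0) an an1 (lexx _)).
rewrite /upper_geometric_sum big_ord_recr/= EFinD addeC leeD//.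
have a1n : (1 <= a ^+ n.+1)%R by rewrite exprn_ege1// ltW.
apply: calibrator_integral_le => //; [exact: f0|exact: ltW|].
move=> x ax xa; have x0 : (0 < x)%R := lt_trans an'0 ax.
apply: f_homo; first by rewrite inv_ge1// (le_trans xa).
by rewrite ler_pdivrMr// mulrC -ler_pdivrMr ?exprn_gt0// div1r ltW.
Qed.

Let integral_le_of_tails a (C : R) : (1 < a)%R ->
  (forall n, I (a ^- n)%R 1%R <= C%:E) -> calibrator_integral f <= C%:E.
Proof.
move=> a1 IC; have a0 : (0 < a)%R by lra.
pose F n := `](a ^- n)%R, (1 : R)%R]%classic.
have FE : \bigcup_n F n = `](0 : R)%R, (1 : R)%R]%classic.
  apply/seteqP; split => x /=.
    move=> [n _]; rewrite /F/= !in_itv/= => /andP[ax ->]; rewrite andbT.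
    by apply: lt_trans ax; have /andP[] := exprN_itv n a1.
  rewrite in_itv/= => /andP[x0 x1].
  have aN1 : (`|a^-1| < 1)%R by rewrite gtr0_norm ?invr_gt0// invf_lt1.
  have /cvgrPdist_lt/(_ _ x0)[n _ /(_ n (leqnn n))] := cvg_expr aN1.
  rewrite /= sub0r normrN gtr0_norm ?exprn_gt0 ?invr_gt0// exprVn => nx.
  by exists n => //; rewrite /F/= in_itv/= nx.
have ndF : nondecreasing_seq F.
  apply/nondecreasing_seqP => n; rewrite subsetEset; apply: subset_itv.
    by rewrite bnd_simp exprN_anti.
  by rewrite bnd_simp.
have an0 n : (0 <= a ^- n)%R by have /andP[/ltW] := exprN_itv n a1.
have := @ge0_nondecreasing_set_cvg_integral _ (measurableTypeR R) R F
  (fun x : R => (f (1 / x)%R)%:E) lebesgue_measure ndF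
  (fun n => measurable_itv _)
  (fun n => measurable_calibrator f_incr (an0 n) (lexx _)).
rewrite FE => cvgI; apply: (lee_cvg_to (cvgI _) (cvg_cst C%:E)).
  move=> n x; rewrite /F/= in_itv/= => /andP[ax x1].
  case: f_incr => f0 _; rewrite lee_fin f0// inv_ge1//.
  exact: le_lt_trans ax.
by apply: nearW => n; exact: IC.
Qed.

(** Two factors of [a] are lost, one in the hypothesis and one between upper
    and lower sums; both vanish as [a] tends to 1. *)
Lemma calibrator_integral_le_sums (C : R) : (0 <= C)%R ->
  (forall a n, (1 < a)%R -> (geometric_sum f a n <= a * C)%R) ->
  calibrator_integral f <= C%:E.
Proof.
move=> C0 SC; apply/lee_addgt0Pr => e e0; rewrite -EFinD.
(* Chosen so that (1 + h)^2 C <= C + e, using (1 + h)^2 <= 1 + 3 h. *)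
pose h := Num.min 1%R (e / (3 * C + 1))%R.
have C1 : (0 < 3 * C + 1)%R by lra.
have h0 : (0 < h)%R by rewrite lt_min ltr01/= divr_gt0.
have h1 : (h <= 1)%R by rewrite ge_min lexx.
have hC : (3 * C * h <= e)%R.
  have : (h <= e / (3 * C + 1))%R by rewrite ge_min lexx orbT.
  by rewrite ler_pdivlMr// => he; lra.
have a1 : (1 < 1 + h)%R by rewrite ltrDl.
apply: (integral_le_of_tails a1) => n.
apply: le_trans (integral_le_upper_sum n a1) _; rewrite lee_fin.
apply: le_trans (upper_geometric_sum_le n f_incr a1) _.
have /ler_wpM2l := SC _ n.+1 a1.
have h10 : (0 <= 1 + h)%R by lra.
move=> /(_ _ h10) /le_trans; apply.
have : (0 <= C * (h * (1 - h)))%R by rewrite !mulr_ge0 ?subr_ge0 ?(ltW h0).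
by lra.
Qed.

End integral.
End geometric_sum.

Section right_limit.
Context {R : realType}.
Variable f : R -> R.
Hypothesis f_incr : increasing_nonneg f.

Definition right_limit (x : R) : R := inf [set f y | y in `]x, +oo[].

Let f0 x : (1 <= x)%R -> (0 <= f x)%R.
Proof. by case: f_incr => + _; apply. Qed.

Let f_homo x y : (1 <= x)%R -> (x <= y)%R -> (f x <= f y)%R.
Proof. by case: f_incr => _; apply. Qed.

Let nonempty_right x : [set f y | y in `]x, +oo[] !=set0.
Proof.
by exists (f (x + 1)%R), (x + 1)%R => //=; rewrite in_itv/= andbT ltrDl.
Qed.

Lemma le_right_limit x : (1 <= x)%R -> (f x <= right_limit x)%R.
Proof.
move=> x1; apply: lb_le_inf => // _ [y /= + <-].
by rewrite in_itv/= andbT => /ltW; exact: f_homo.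
Qed.

Lemma right_limit_le x y : (1 <= x)%R -> (x < y)%R -> (right_limit x <= f y)%R.
Proof.
move=> x1 xy; apply: ge_inf; last by exists y => //=; rewrite in_itv/= andbT.
exists (f x) => _ [z /= + <-]; rewrite in_itv/= andbT => /ltW; exact: f_homo.
Qed.

Lemma right_limit_increasing : increasing_nonneg right_limit.
Proof.
split=> [x x1|x y x1]; first exact: le_trans (f0 x1) (le_right_limit x1).
rewrite le_eqVlt => /orP[/eqP->//|xy].
apply: le_trans (right_limit_le x1 xy) (le_right_limit _).
exact: le_trans (ltW xy).
Qed.

Lemma right_limit_continuous : right_continuous_from1 right_limit.
Proof.
move=> x x1; apply/cvgrPdist_lt => e e0.
have inff : has_inf [set f y | y in `]x, +oo[].
  split=> //; exists (f x) => _ [z /= + <-].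
  by rewrite in_itv/= andbT => /ltW; exact: f_homo.
have [_ [y /= + <-] fy] := inf_adherent e0 inff.
rewrite in_itv/= andbT => xy.
apply: filterS2 (nbhs_right_gt x) (nbhs_right_lt xy) => z xz zy.
have z1 : (1 <= z)%R := le_trans x1 (ltW xz).
have h1 := right_limit_le z1 zy.
have h2 := right_limit_increasing.2 _ _ x1 (ltW xz).
rewrite ler0_norm ?subr_le0// opprB ltrBlDl.
exact: le_lt_trans h1 fy.
Qed.

(** The lower sum of the right limit is at most the upper sum of [f], which
    avoids the countability of the discontinuities. *)
Lemma right_limit_integral_le1 :
  calibrator_integral f <= 1 -> calibrator_integral right_limit <= 1.
Proof.
move=> f1.
apply: (calibrator_integral_le_sums right_limit_increasing) => // a n a1.
apply: (@le_trans _ _ (upper_geometric_sum f a n)).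
  apply: le_geometric_sum => // x x1; apply: right_limit_le => //.
  by rewrite ltr_pMl//; lra.
apply: le_trans (upper_geometric_sum_le n f_incr a1) _.
apply: ler_wpM2l; first by lra.
by rewrite -lee_fin; apply: le_trans (geometric_sum_le_integral f_incr _ a1) f1.
Qed.

End right_limit.

(** * Necessity of the integral condition *)
Section nested_bets.
Context {d : measure_display} {T : measurableType d} {R : realType}.
Variables (P : probability T R) (a : R) (A : (set T)^nat).
Hypotheses (a1 : (1 < a)%R) (mA : forall n, measurable (A n)).
Hypothesis PA : forall n, P (A n) = (a ^- n)%:E.
Hypothesis A_decr : forall m n, (m <= n)%N -> A n `<=` A m.

Local Notation time := (@time_set R DiscreteTime).

(** Outcomes in the event of time [t] are indistinguishable at that time, and
    all others are fully known.  The truncation extends the family from the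
    natural times to the real index set. *)
Definition nested_filtration (t : R) : set (set T) :=
  [set B | measurable B /\
    (A (Num.truncn t) `<=` B \/ B `&` A (Num.truncn t) = set0)].

Definition nested_bet (t : R) (w : T) : \bar R :=
  (a ^+ Num.truncn t * \1_(A (Num.truncn t)) w)%:E.

Let a0 : (0 < a)%R. Proof. by have := a1; lra. Qed.

Let bet_ge0 t w : 0 <= nested_bet t w.
Proof. by rewrite lee_fin mulr_ge0 ?exprn_ge0 ?(ltW a0)// indicE ler0n. Qed.

Let mbet t : measurable_fun setT (nested_bet t).
Proof.
by apply/measurable_EFinP; exact: measurable_funM.
Qed.

(* The integral over a known event does not depend on the later time u; this
   is the martingale property. *)
Let bet_integral t B : nested_filtration t B -> forall u, (t <= u)%R ->
  \int[P]_(w in B) nested_bet u w =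
  if pselect (A (Num.truncn t) `<=` B) then 1 else 0.
Proof.
move=> [mB AB] u tu; set k := Num.truncn u.
have ktu : (Num.truncn t <= k)%N by exact: le_truncn.
under eq_integral do rewrite /nested_bet -/k EFinM.

rewrite ge0_integralZl//; last 2 first.
- by apply/measurable_EFinP; exact: measurable_indic.
- by rewrite lee_fin exprn_ge0// ltW.
rewrite integral_indic//.
case: pselect => [AtB|AtB].
  rewrite (_ : A k `&` B = A k); last first.
    by apply/setIidPl; apply: subset_trans AtB; exact: A_decr.
  by rewrite /= PA -EFinM divff// gt_eqF// exprn_gt0.
case: AB => // BA; rewrite (_ : A k `&` B = set0) ?measure0 ?mule0//.
rewrite setIC -subset0 -BA; apply: setIS; exact: A_decr.
Qed.

Let sub_sigma t : is_sub_sigma_algebra (nested_filtration t).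
Proof.
split; last by move=> B [].
set k := Num.truncn t; split.
- by split => //; right; rewrite set0I.
- move=> B [mB AB]; split; first by apply: measurableD.
  rewrite -/k in AB *; case: AB => AB.
    right; apply/seteqP; split => // w [[_ Bw] Aw]; exact: Bw (AB _ Aw).
  by left => w Aw; split => // Bw; rewrite -[False]/(set0 w) -AB.
- move=> B AB; split; first by apply: bigcup_measurable => i _; case: (AB i).
  rewrite -/k; have [[i AiB]|Bn] := pselect (exists i, A k `<=` B i).
    by left => w /AiB Bw; exists i.
  right; rewrite setI_bigcupl; apply: bigcup0 => i _.
  by case: (AB i) => _ [ABi|//]; case: Bn; exists i.
Qed.

Lemma nested_bet_test :
  test_supermartingale P DiscreteTime nested_bet nested_filtration.
Proof.
have FT t : nested_filtration t setT by split => //; left.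
have int_bet t : P.-integrable setT (nested_bet t).
  apply/integrableP; split => //.
  under eq_integral do rewrite gee0_abs//.
  by rewrite (bet_integral (FT t) (lexx t)); case: pselect => h; exact: ltry.
have bet_wrt t : measurable_wrt (nested_filtration t) (nested_bet t).
  move=> B mB; split; first by rewrite -[X in measurable X]setTI; exact: mbet.
  have betE w : A (Num.truncn t) w -> nested_bet t w = (a ^+ Num.truncn t)%:E.
    by move=> Aw; rewrite /nested_bet indicE mem_set// mulr1.
  have [Ba|Ba] := pselect (B (a ^+ Num.truncn t)%:E).
    by left => w Aw; rewrite /= betE.
  by right; apply/seteqP; split => // w [/= + Aw]; rewrite betE.
split=> [|t _ w|]; [|exact: bet_ge0|]; last first.
  rewrite (bet_integral (FT 0%R) (lexx _)).
  by case: pselect => h; [exact: lexx|exact: lee01].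
split=> //; first split=> //.
- move=> s t _ _ /ltW st B [mB AB]; split=> //.
  have Ast : A (Num.truncn t) `<=` A (Num.truncn s) by apply/A_decr/le_truncn.
  case: AB => AB; [left; exact: subset_trans AB|right].
  by rewrite -subset0 -AB; exact: setIS.
- move=> s t _ _ /ltW st; exists (nested_bet s); last by apply: aeW => w.
  split => // B FB; rewrite (bet_integral FB (lexx _)).
  by rewrite (bet_integral FB st).
Qed.

(** On [A k] minus [A k.+1], with [k < n], the running maximum at time [n] is
    at least [a ^+ k], so the sum is a lower bound for the expectation of any
    test supermartingale above [f] of the running maximum. *)
Lemma calibrator_geometric_sum_le1 (f : R -> R) n :
  martingale_calibrator f -> (geometric_sum f a n <= 1)%R.
Proof.
move=> [[f0 f_homo] fcal].
have [Y Ytest YM] := fcal _ _ _ _ _ _ nested_bet_test.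
pose N : R := n%:R.
have hN : time N by exists n.
have h0 : time 0%R by exists 0%N.
have N0 : (0 <= N)%R by rewrite ler0n.
have mY : measurable_fun setT (Y N).
  by case: Ytest => -[_ /(_ _ hN)[_ /integrableP[]]].
have Y0 w : 0 <= Y N w by case: Ytest => _ + _; apply.
have Y1 : \int[P]_w Y N w <= 1.
  apply: le_trans (test_supermartingale_integral_le Ytest h0 hN N0 _) _.
    by split => //; left.
  by case: Ytest.
have step k : (k < n)%N -> (f (a ^+ k) * (a ^- k - a ^- k.+1))%:E <=
    \int[P]_(w in A k `\` A k.+1) Y N w.
  move=> kn; have mD : measurable (A k `\` A k.+1) by exact: measurableD.
  have PD : P (A k `\` A k.+1) = (a ^- k - a ^- k.+1)%:E.
    rewrite measureD//; last by rewrite ltey_eq fin_num_measure.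
    rewrite (_ : A k `&` A k.+1 = A k.+1); last first.
      by apply/setIidPr; exact: A_decr.
    by rewrite /= !PA EFinB.
  rewrite EFinM -PD -integral_cst//.
  apply: ae_ge0_le_integral => //.
  - by move=> w _; rewrite lee_fin f0// exprn_ege1// ltW.
  - exact: measurable_funTS.
  apply: filterS YM => w /(_ _ hN) fY [Aw _]; apply: le_trans fY.
  have Mle : running_sup DiscreteTime nested_bet N w <= (a ^+ n)%:E.
    rewrite ge_max; apply/andP; split.
      by rewrite lee_fin exprn_ege1// ltW.
    apply: ge_ereal_sup => _ [_ [[i _ <-] /= iN] <-].
    rewrite /nested_bet natrK lee_fin.
    apply: (@le_trans _ _ (a ^+ i)%R).
      by rewrite ler_piMr ?exprn_ge0 ?(ltW a0)// indicE lern1 leq_b1.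
    by rewrite ler_weXn2l ?ltW// -(ler_nat R).
  have Mge : (a ^+ k)%:E <= running_sup DiscreteTime nested_bet N w.
    apply: le_trans (running_sup_ge (s := k%:R) _ w _ _); last 2 first.
    - by exists k.
    - by rewrite ler_nat ltnW.
    by rewrite /nested_bet natrK indicE mem_set// mulr1.
  case: (running_sup _ _ _ w) Mle Mge => [r|//|//] _ /=; rewrite !lee_fin => kr.
  by rewrite f_homo// exprn_ege1// ltW.
rewrite -lee_fin; apply: le_trans Y1.
suff : forall k, (k <= n)%N ->
    (geometric_sum f a k)%:E <= \int[P]_(w in ~` A k) Y N w.
  move=> /(_ n (leqnn n)) /le_trans; apply; apply: ge0_subset_integral => //.
  exact: measurableC.
elim=> [|k IH] kn.
  by rewrite /geometric_sum big_ord0; exact: integral_ge0.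
have AkE : ~` A k.+1 = ~` A k `|` (A k `\` A k.+1).
  apply/seteqP; split => w /=.
    by move=> Ak1; have [Ak|] := pselect (A k w); [right|left].
  by case=> [Ak /(A_decr (leqnSn k))//|[]].
rewrite AkE ge0_integral_setU//.
- by rewrite /geometric_sum big_ord_recr/= EFinD leeD ?IH ?step// ltnW.
- exact: measurableC.
- exact: measurableD.
- exact: measurable_funTS.
- rewrite disj_set2E; apply/eqP/seteqP; split => // w [/= nA [Aw _]]; exact: nA.
Qed.

End nested_bets.

Section necessity.
Context {R : realType}.

Let uniform_prob_tail (u : R) : (0 < u <= 1)%R ->
  uniform_prob (@ltr01 R) `]-oo, u]%classic = u%:E.
Proof.
move=> /andP[u0 u1]; rewrite /uniform_prob integral_uniform_pdf.
have -> : `]-oo, u]%classic `&` `[0%R, 1%R]%classic = `[0%R, u]%classic.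
  apply/seteqP; split => x /=; rewrite !in_itv/=; first by case=> -> /andP[->].
  by move=> /andP[x0 xu]; rewrite xu x0 (le_trans xu).
rewrite (eq_integral (cst 1)); last first.
  move=> x; rewrite inE/= in_itv/= => /andP[x0 xu].
  by rewrite /uniform_pdf x0 (le_trans xu)//= subr0 invr1.
by rewrite integral_cst//= mul1e lebesgue_measure_itv/= lte_fin u0 sube0.
Qed.

(** The uniform distribution on the unit interval provides nested events of
    probabilities [a ^- k]. *)
Lemma calibrator_integral_le1 (f : R -> R) :
  martingale_calibrator f -> calibrator_integral f <= 1.
Proof.
move=> fcal; apply: (calibrator_integral_le_sums fcal.1) => // a n a1.
rewrite mulr1; apply: le_trans (ltW a1).
pose A k := `]-oo, (a ^- k)%R]%classic : set (measurableTypeR R).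
apply: (@calibrator_geometric_sum_le1 _ _ R
  (uniform_prob (@ltr01 R)) a A) => //.
- by move=> k; exact: measurable_itv.
- by move=> k; rewrite -uniform_prob_tail//; exact: exprN_itv.
- move=> k m km; apply: subset_itvl; rewrite bnd_simp.
  have a0 : (0 < a)%R by lra.
  by rewrite lef_pV2 ?posrE ?exprn_gt0// ler_weXn2l ?ltW.
Qed.

End necessity.

(** * Admissible calibrators *)
Section admissibility.
Context {R : realType}.
Implicit Types f g : R -> R.

Local Notation I f a b :=
  (\int[lebesgue_measure]_(x in `]a, b]) (f (1 / x)%R)%:E).

(** The capital is built from the right limit of [f], since its paths and the
    passage to continuous time need right-continuity. *)
Lemma integral_le1_calibrator f : increasing_nonneg f ->
  calibrator_integral f <= 1 -> martingale_calibrator f.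
Proof.
move=> f_incr f1; split=> // d T P tm X F Xtest.
have fp_incr := right_limit_increasing f_incr.
have [c fc fc1] :=
  calibrator_reserve_pair fp_incr (right_limit_integral_le1 f_incr f1).
exists (fun t w => wealth (right_limit f) c (running_sup tm X t w) (X t w)).
  apply: (wealth_test_supermartingale Xtest fc) => //.
  exact: right_limit_continuous.
apply: aeW => w t ht; apply: (extend_le_wealth Xtest fc) => // x x1.
exact: le_right_limit.
Qed.

Let calibrator_integral_shift f (k : R) : increasing_nonneg f -> (0 <= k)%R ->
  calibrator_integral (fun x => f x + k)%R = calibrator_integral f + k%:E.
Proof.
move=> f_incr k0; rewrite /calibrator_integral.
under eq_integral do rewrite EFinD.
rewrite ge0_integralD//.
- by rewrite integral_cst_itv// subr0 mulr1.
- move=> x /=; rewrite in_itv/= => /andP[x0 x1].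
  by rewrite lee_fin (f_incr.1)// inv_ge1.
- exact: (measurable_calibrator f_incr).
Qed.

Let calibrator_integral_homo f g (a b : R) :
  increasing_nonneg f -> increasing_nonneg g ->
  dominates g f -> (0 <= a)%R -> (b <= 1)%R -> I f a b <= I g a b.
Proof.
move=> fi gi gf a0 b1; have inv1 x : x \in `]a, b] -> (1 <= 1 / x)%R.
  rewrite in_itv/= => /andP[ax xb]; apply: inv_ge1; last exact: le_trans b1.
  exact: le_lt_trans ax.
apply: ge0_le_integral => //.
- by move=> x /inv1 x1; rewrite lee_fin fi.1.
- exact: measurable_calibrator.
- exact: measurable_calibrator.
- by move=> x /inv1 x1; rewrite lee_fin gf.
Qed.

(** If [g] exceeds [f] by [2 e] at [x0] then, [g] being increasing and [f]
    right-continuous, it exceeds [f] by [e] on an interval from [x0] to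
    [x0 + r], which adds [e (b - a)] to the integral. *)
Lemma integral_eq1_admissible f : martingale_calibrator f ->
  right_continuous_from1 f -> calibrator_integral f = 1 -> admissible f.
Proof.
move=> fcal rf f1; split=> // -[g [gcal gf [x0 x01 fgx0]]].
have f_incr := fcal.1; have g_incr := gcal.1.
pose e := ((g x0 - f x0) / 2)%R.
have e0 : (0 < e)%R by rewrite divr_gt0// subr_gt0.
have /cvgrPdist_lt/(_ _ e0)[r /= r0 fr] := rf _ x01.
pose a := (1 / (x0 + r))%R; pose b := (1 / x0)%R.
have x00 : (0 < x0)%R by lra.
have xr0 : (0 < x0 + r)%R by lra.
have a0 : (0 < a)%R by rewrite /a div1r invr_gt0.
have ab : (a < b)%R by rewrite /a /b !div1r ltf_pV2// ltrDl.
have b1 : (b <= 1)%R by rewrite /b div1r invf_le1.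
have near_x0 x : (a < x)%R -> (x <= b)%R -> (f (1 / x) + e <= g (1 / x))%R.
  move=> ax xb; have x_gt0 := lt_trans a0 ax.
  have x0x : (x0 <= 1 / x)%R by rewrite ler_pdivlMr// mulrC -ler_pdivlMr.
  have xr : (1 / x < x0 + r)%R by rewrite ltr_pdivrMr// mulrC -ltr_pdivrMr.
  have := g_incr.2 _ _ x01 x0x.
  have gE : (g x0 = f x0 + e + e)%R by rewrite /e; lra.
  suff : (f (1 / x) < f x0 + e)%R by lra.
  move: x0x; rewrite le_eqVlt => /orP[/eqP <-|x0x]; first by rewrite ltrDl.
  have := fr (1 / x)%R; rewrite /= ltr0_norm ?subr_lt0// opprB ltrBlDl.
  move=> /(_ xr x0x); rewrite ler0_norm; first by rewrite opprB ltrBlDl.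
  by rewrite subr_le0 f_incr.2// ltW.
have mid : I f a b + (e * (b - a))%:E <= I g a b.
  have -> : (e * (b - a))%:E =
      \int[lebesgue_measure]_(x in `]a, b]) e%:E.
    by rewrite integral_cst_itv// ltW.
  have fge0 x : x \in `]a, b] -> 0 <= (f (1 / x))%:E.
    rewrite in_itv/= => /andP[ax xb]; rewrite lee_fin f_incr.1//.
    by apply: inv_ge1; [exact: lt_trans ax|exact: le_trans b1].
  have mf := measurable_calibrator f_incr (ltW a0) b1.
  rewrite -ge0_integralD//; last by move=> x _; rewrite lee_fin ltW.
  apply: ge0_le_integral => //.
  - by move=> x /fge0 fx; rewrite adde_ge0// lee_fin ltW.
  - exact: emeasurable_funD.
  - exact: (measurable_calibrator g_incr (ltW a0) b1).
  - move=> x /=; rewrite in_itv/= => /andP[ax xb].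
    by rewrite -EFinD lee_fin near_x0.
have := calibrator_integral_le1 gcal.
have := f1; rewrite /calibrator_integral.
have splitI h : increasing_nonneg h ->
    I h 0%R 1%R = I h 0%R a + I h a b + I h b 1%R.
  move=> hi; have b0 := lt_trans a0 ab.
  rewrite (calibrator_integral_split hi (b := b))// ?ltW//.
  by rewrite (calibrator_integral_split hi (b := a) (e := b))// ltW.
move=> If1; rewrite leNgt => /negP; apply.
apply: (@lt_le_trans _ _ (1 + (e * (b - a))%:E)).
  by rewrite -EFinD lte_fin ltrDl mulr_gt0// subr_gt0.
rewrite -If1 !splitI// [leLHS]addeAC; apply: leeD; last first.
  by apply: calibrator_integral_homo => //; exact: ltW (lt_trans a0 ab).
rewrite -addeA; apply: leeD => //.
by apply: calibrator_integral_homo => //; rewrite (le_trans (ltW ab)).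
Qed.

(** Passing to the right limit keeps the integral at most 1, and a constant
    makes up the deficit. *)
Lemma admissible_majorant f : martingale_calibrator f ->
  exists g, [/\ martingale_calibrator g, dominates g f,
    right_continuous_from1 g & calibrator_integral g = 1].
Proof.
move=> fcal; have f_incr := fcal.1.
have fp_incr := right_limit_increasing f_incr.
have fp1 := right_limit_integral_le1 f_incr (calibrator_integral_le1 fcal).
have fp0 : 0 <= calibrator_integral (right_limit f).
  exact: (calibrator_integral_ge0 fp_incr (lexx _) (lexx _)).
have fpfin : calibrator_integral (right_limit f) \is a fin_num.
  by rewrite ge0_fin_numE// (le_lt_trans fp1)// ltry.
pose k := (1 - fine (calibrator_integral (right_limit f)))%R.
have k0 : (0 <= k)%R by rewrite subr_ge0 -lee_fin fineK.
pose g := (fun x => right_limit f x + k)%R.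
have g1 : calibrator_integral g = 1.
  rewrite calibrator_integral_shift// -(fineK fpfin) -EFinD /k.
  by rewrite addrC subrK.
have g_incr : increasing_nonneg g.
  split=> [x x1|x y x1 xy]; first by rewrite addr_ge0// fp_incr.1.
  by rewrite lerD2r fp_incr.2.
exists g; split=> //.
- by apply: integral_le1_calibrator => //; rewrite g1.
- by move=> x x1; rewrite ler_wpDr// le_right_limit.
- by move=> x x1; apply: cvgD; [exact: right_limit_continuous|exact: cvg_cst].
Qed.

End admissibility.

Theorem theorem4 (R : realType) :
  [/\ forall f : R -> R, increasing_nonneg f ->
        (martingale_calibrator f <-> (calibrator_integral f <= 1)%E),
      forall f : R -> R, martingale_calibrator f ->
        exists2 g : R -> R, admissible g & dominates g f &
      forall f : R -> R, martingale_calibrator f ->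
        (admissible f <->
          right_continuous_from1 f /\ calibrator_integral f = 1%E)].
Proof.
split.
- move=> f f_incr; split; first exact: calibrator_integral_le1.
  exact: integral_le1_calibrator.
- move=> f /admissible_majorant[g [gcal gf rg g1]]; exists g => //.
  exact: integral_eq1_admissible.
- move=> f fcal; split; last by case; exact: integral_eq1_admissible.
  case=> _ fmax; have [g [gcal gf rg g1]] := admissible_majorant fcal.
  have fg x : (1 <= x)%R -> f x = g x.
    move=> x1; apply/eqP; rewrite eq_le gf//= leNgt; apply/negP => fx.
    by apply: fmax; exists g; split=> //; exists x.
  split.
    move=> x x1; rewrite fg//.
    apply: (cvg_trans (G := g y @[y --> x^'+])); last exact: rg.
    apply: near_eq_cvg; apply: filterS (nbhs_right_gt x) => y /ltW xy.
    by rewrite fg// (le_trans x1).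
  rewrite -g1; apply: eq_integral => x; rewrite inE/= in_itv/= => /andP[x0 x1].
  by rewrite fg// inv_ge1.
Qed.
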